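(* The antipode of the Hopf monoid of paths $\mathbf F$ is given by the following cancellation-free and grouping-free expression. If $l$ is a path on $I$, then $$\mathsf s_I(l)=\sum_{\pi\in NC(l)}(-1)^{|\pi|}\,C_{(\overline\pi:\pi)}\,l(\pi),$$ summing over all the noncrossing partitions $\pi$ of $l$. Here $|\pi|$ is the number of blocks of $\pi$, $l(\pi)$ denotes the linear graph of $\pi$, $\overline\pi=\{p_1,\dots,p_k\}$ is the adjacent closure of $\pi$, and $C_{(\overline\pi:\pi)}=\prod_{p_i\in\overline\pi}C_{n_i}$, where $n_i$ is the number of blocks of $\pi$ refining block $p_i$ of $\overline\pi$ and $C_n=\frac1{n+1}\binom{2n}n$.
   Context: A set of paths on a finite set $I$ is a graph on vertex set $I$ whose connected components are paths; equivalently a set partition of $I$ with a linear order, considered up to reversal, on each block. $\mathrm F[I]$ is the collection of sets of paths on $I$, and $\mathbf F[I]$ is the vector space with basis $\mathrm F[I]$ over a field of characteristic $0$. For an ordered decomposition $I=S\sqcup T$, the product of two sets of paths on $S$ and $T$ is their disjoint union. The coproduct of $\alpha\in\mathrm F[I]$ is $\Delta_{S,T}(\alpha)=\alpha|_S\otimes\alpha/_S$, where in $\alpha|_S$ each path $s$ of $\alpha$ meeting $S$ gives rise to a single path on the vertices of $s$ in $S$, with the order inherited from $s$, while $\alpha/_S$ is the induced subgraph of $\alpha$ on $T$. These make $\mathbf F$ a connected Hopf monoid. With $\mu_{S_1,\dots,S_k},\Delta_{S_1,\dots,S_k}$ the iterated (co)products, the antipode is $\mathsf s_\emptyset=\mathrm{id}$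 and, for $I\neq\emptyset$, $\mathsf s_I=\sum(-1)^k\mu_{S_1,\dots,S_k}\circ\Delta_{S_1,\dots,S_k}$, over all $k\ge1$ and ordered sequences of nonempty pairwise disjoint $S_1,\dots,S_k$ with union $I$. A path $l$ on $I$ means a single path with vertex set $I$; choose one of its two linear orders $<$ and identify $I$ with $\{1,\dots,n\}$ and $l$ with the path $12\cdots n$. A set partition $\pi$ of $I$ is noncrossing if there are no blocks $p_i\ne p_j$ and elements $a<b<c<d$ with $a,c\in p_i$ and $b,d\in p_j$; $NC(l)$ is the set of noncrossing partitions. The linear graph $l(\pi)$ is the set of paths on $I$ having one path for each block of $\pi$, with the order induced by $l$. The adjacent closure $\overline\pi$ is the partition obtained from $\pi$ by successively merging any two blocks $S_1$ and $S_2$ with $\max S_1=b$ and $\min S_2=b+1$ for some $b$, until no such pair remains. An expression $\sum_\alpha c_\alpha x_\alpha$ in basis elements is cancellation-free if no $\alpha\ne\beta$ have $x_\alpha=x_\beta$ with $c_\alpha,c_\beta$ of opposite sign, and grouping-free if the $x_\alpha$ are pairwise distinct. *)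

(* Defs.v *)
From HB Require Import structures.
From mathcomp Require Import all_boot all_order all_algebra.
Set Implicit Arguments.
Unset Strict Implicit.
Unset Printing Implicit Defensive.
Import GRing.Theory.

(* A graph is given by its set of edges, an edge being a 2-element set of
   vertices; its vertex set is a subset of an ambient finite type U. *)

Section Graphs.
Variable U : finType.
Implicit Types (I S T C e : {set U}) (alpha beta : {set {set U}}).
Implicit Types (s t w : seq U) (ss : seq (seq U)).

Fixpoint path_edges s : {set {set U}} :=
  if s is x :: t then
    if t is y :: _ then [set x; y] |: path_edges t else set0
  else set0.

Definition adj alpha : rel U := fun x y => [set x; y] \in alpha.

Definition component alpha (x : U) : {set U} := [set y | connect (adj alpha) x y].

Definition induced alpha T : {set {set U}} := [set e in alpha | e \subset T].

(* The linear orders on C, given as duplicate-free listings, for which the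
   subgraph of alpha induced on C is the path through C in that order. A path
   has its two orders; a non-path has none. *)
Definition orders alpha C : seq (seq U) :=
  [seq s <- permutations (enum C) | path_edges s == induced alpha C].

Definition is_pathset I alpha : bool :=
  [forall e in alpha, (#|e| == 2) && (e \subset I)]
  && [forall x in I, orders alpha (component alpha x) != [::]].

(* Each path of alpha keeps only its vertices in S, in the inherited order;
   the two orders of a path contribute the same edges. *)
Definition shortcut I alpha S : {set {set U}} :=
  \bigcup_(x in I) \bigcup_(s <- orders alpha (component alpha x))
    path_edges [seq y <- s | y \in S].

Lemma path_edges_cons2 x y s :
  path_edges [:: x, y & s] = [set x; y] |: path_edges (y :: s).
Proof. by []. Qed.

Lemma path_edges_mem s e x : e \in path_edges s -> x \in e -> x \in s.
Proof.
elim: s => [|a [|b t] IH]; [by rewrite inE | by rewrite inE |].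
rewrite path_edges_cons2 in_setU1 => /orP[/eqP->|et xe].
  by rewrite !inE => /orP[]->; rewrite ?orbT.
by rewrite in_cons IH ?orbT.
Qed.

Lemma path_edges_card s e : uniq s -> e \in path_edges s -> #|e| = 2.
Proof.
elim: s => [|a [|b t] IH]; [by rewrite inE | by rewrite inE | move=> us].
rewrite path_edges_cons2 in_setU1 => /orP[/eqP->|et].
  by rewrite cards2; move: us; rewrite /= !inE negb_or => /andP[/andP[->]].
by apply: IH => //; case/andP: us.
Qed.

Lemma path_edges_cat s x t :
  path_edges (s ++ x :: t) = path_edges (rcons s x) :|: path_edges (x :: t).
Proof.
elim: s => [|a [|b s] IH]; rewrite ?set0U //=.
  by rewrite setU0.
by rewrite -setUA; congr (_ |: _); exact: IH.
Qed.

Lemma path_edges_rev s : path_edges (rev s) = path_edges s.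
Proof.
elim: s => [|a [|b t] IH] //.
rewrite !rev_cons -!cats1 -catA (path_edges_cat _ b [:: a]) -rev_cons IH.
by rewrite [path_edges [:: b; a]]/= setU0 setUC [[set b; a]]setUC.
Qed.

Lemma adjC alpha x y : adj alpha x y = adj alpha y x.
Proof. by rewrite /adj setUC. Qed.

Lemma connect_adjC alpha : connect_sym (adj alpha).
Proof. exact: sym_connect_sym (@adjC alpha). Qed.

Lemma path_edges_connect s alpha x y : path_edges s \subset alpha ->
  x \in s -> y \in s -> connect (adj alpha) x y.
Proof.
suff H a t z : path_edges (a :: t) \subset alpha -> z \in a :: t ->
    connect (adj alpha) a z.
  case: s => // a t sub xs ys; apply: connect_trans (H _ _ _ sub ys).
  by rewrite connect_adjC; apply: H sub xs.
elim: t a => [|b t IH] a; first by rewrite !inE => _ /eqP->; exact: connect0.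
move=> sub; rewrite inE => /orP[/eqP->|zt]; first exact: connect0.
have ab : adj alpha a b by apply: (subsetP sub); rewrite /= !inE eqxx.
apply: connect_trans (connect1 ab) (IH _ _ zt).
by apply: subset_trans sub; exact: subsetUr.
Qed.

Lemma flatten_inj ss s t x : uniq (flatten ss) -> s \in ss -> t \in ss ->
  x \in s -> x \in t -> s = t.
Proof.
elim: ss => // r ss IH /=; rewrite cat_uniq => /and3P[_ nh u].
have nr v : v \in ss -> x \in v -> x \notin r.
  move=> vs xv; apply: contra nh => xr; apply/hasP; exists x => //.
  by apply/flattenP; exists v.
rewrite !inE => /orP[/eqP->|s1] /orP[/eqP->|t1] //.
- by move=> xr xt; move: (nr _ t1 xt); rewrite xr.
- by move=> xs xr; move: (nr _ s1 xs); rewrite xr.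
- exact: IH.
Qed.

Lemma mem_bigcup_seq (J : eqType) (r : seq J) (F : J -> {set {set U}}) e :
  reflect (exists2 j, j \in r & e \in F j) (e \in \bigcup_(j <- r) F j).
Proof.
elim: r => [|j r IH]; first by rewrite big_nil inE; constructor; case.
rewrite big_cons in_setU; apply: (iffP orP) => [[ej|/IH[k kr ek]]|[k]].
- by exists j; rewrite ?mem_head.
- by exists k; rewrite // inE kr orbT.
- by rewrite inE => /orP[/eqP->|kr ek]; [left | right; apply/IH; exists k].
Qed.

(* Two listings of the same path are equal or reverse of each other. *)
Lemma path_edges_inj_head x s t : uniq (x :: s) -> uniq (x :: t) ->
  s =i t -> path_edges (x :: s) = path_edges (x :: t) -> s = t.
Proof.
elim: s x t => [|a s IH] x [|b t] //.
- by move=> _ _ /(_ b); rewrite inE eqxx.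
- by move=> _ _ /(_ a); rewrite inE eqxx.
move=> us ut st E.
have nx r c f : uniq [:: x, c & r] -> f \in path_edges (c :: r) -> x \notin f.
  by case/andP=> + _ => /[swap] fr; apply: contra => /(path_edges_mem fr).
have ab : a = b.
  have : [set x; a] \in path_edges [:: x, b & t] by rewrite -E /= !inE eqxx.
  rewrite path_edges_cons2 in_setU1 => /orP[/eqP/setP/(_ a)|/nx].
    rewrite !inE eqxx orbT => /esym/orP[/eqP ax|/eqP //].
    by move: us; rewrite ax /= inE eqxx.
  by move=> /(_ ut); rewrite !inE eqxx.
rewrite -ab in ut st E *; congr (_ :: _).
case/andP: (us) => _ us'; case/andP: (ut) => _ ut'.
apply: (IH a) => // [z|].
  move: (st z); rewrite !inE; case: eqVneq => [->|] //= _.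
  by move: us' ut' => /= /andP[/negPf-> _] /andP[/negPf-> _].
apply/setP => f; move/setP/(_ f): E; rewrite !path_edges_cons2 !in_setU1.
case: eqVneq => [->|] //= _.
by apply/idP/idP => [/(nx _ _ _ us)|/(nx _ _ _ ut)]; rewrite !inE eqxx.
Qed.

Lemma path_edges_inj s t : uniq s -> uniq t -> s =i t ->
  path_edges s = path_edges t -> s = t \/ s = rev t.
Proof.
case: s => [|x s] us ut st E.
  by left; case: t {ut E} st => // b t /(_ b); rewrite !inE eqxx.
have xt : x \in t by rewrite -st mem_head.
case/splitPr: t / xt ut st E => p q ut st E.
have tailE r : uniq (x :: r) -> x :: s =i x :: r -> s =i r.
  move=> ur sr z; move: (sr z); rewrite !inE; case: eqVneq => [->|] //= _.
  by move: us ur => /= /andP[/negPf-> _] /andP[/negPf-> _].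
case/lastP: p => [|p a] in ut st E *.
  by left; congr (_ :: _); apply: path_edges_inj_head E => //; exact: tailE.
case: q => [|b q] in ut st E *.
  right; rewrite cats1 rev_rcons in st E ut *; congr (_ :: _).
  have ur : uniq (x :: rev (rcons p a)) by rewrite -rev_rcons rev_uniq.
  apply: (path_edges_inj_head (x := x)) => //.
    by apply: tailE => // z; rewrite st -rev_rcons mem_rev.
  by rewrite -rev_rcons path_edges_rev.
have H c : [set x; c] \in path_edges (x :: s) -> c != x -> ohead s = Some c.
  case: (s) us => [|d s'] us'; first by rewrite inE.
  rewrite path_edges_cons2 in_setU1.
  case/orP=> [/eqP/setP/(_ c)|xc].
    by rewrite !inE eqxx orbT => /esym/orP[]/eqP->; rewrite ?eqxx.
  by case/andP: us'; rewrite (path_edges_mem xc) // !inE eqxx.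
have ax : a != x.
  apply: contraTneq ut => ->; rewrite cat_uniq /= mem_rcons mem_head.
  by rewrite andbF.
have bx : b != x.
  by apply: contraTneq ut => ->; rewrite cat_uniq /= mem_head !andbF.
have ha : ohead s = Some a.
  apply: H ax; rewrite E path_edges_cat in_setU -cats1 -cats1 -catA.
  by rewrite path_edges_cat in_setU /= setU0 !inE [[set x; a]]setUC eqxx orbT.
have hb : ohead s = Some b.
  by apply: H bx; rewrite E path_edges_cat in_setU /= !inE eqxx orbT.
move: ha; rewrite hb => -[ba]; move: ut; rewrite ba cat_uniq /= => /and3P[_].
by rewrite !mem_rcons !inE eqxx !orbT.
Qed.

Lemma ordersP alpha C s : reflect
  [/\ uniq s, s =i C & path_edges s = induced alpha C] (s \in orders alpha C).
Proof.
rewrite mem_filter mem_permutations; apply: (iffP andP) => [[/eqP E p]|[u m E]].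
  split=> // [|z]; first by rewrite (perm_uniq p) enum_uniq.
  by rewrite (perm_mem p) mem_enum.
rewrite E eqxx; split=> //; apply: uniq_perm; rewrite ?enum_uniq // => z.
by rewrite m mem_enum.
Qed.

Section Decomposition.
Variables (ss : seq (seq U)) (alpha : {set {set U}}).
Hypotheses (uss : uniq (flatten ss))
  (alphaE : alpha = \bigcup_(s <- ss) path_edges s).

Lemma edges_unique_path e s x : s \in ss -> x \in s -> e \in alpha -> x \in e ->
  e \in path_edges s.
Proof.
move=> sss xs; rewrite alphaE => /mem_bigcup_seq[t tss et] xe.
by rewrite (flatten_inj uss sss tss xs (path_edges_mem et xe)).
Qed.

Lemma path_component s x : s \in ss -> x \in s -> component alpha x = [set y in s].
Proof.
move=> sss xs; apply/setP => y; rewrite !inE; apply/idP/idP; last first.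
  apply: path_edges_connect xs; rewrite alphaE; apply/subsetP => e es.
  by apply/mem_bigcup_seq; exists s.
move=> /closed_connect-/(_ (mem s)) <- // {y} y z yz.
have H a b : [set a; b] \in alpha -> a \in s -> b \in s.
  move=> ab ia; have es := edges_unique_path sss ia ab (set21 a b).
  by apply: (path_edges_mem es); rewrite set22.
by apply/idP/idP; apply: H => //; rewrite setUC.
Qed.

Lemma path_uniq s : s \in ss -> uniq s.
Proof.
move: uss; elim: ss => // r ss' IH /=; rewrite cat_uniq inE.
by case/and3P=> ur _ u /orP[/eqP->|/IH->].
Qed.

Lemma path_orders s x : s \in ss -> x \in s -> s \in orders alpha (component alpha x).
Proof.
move=> sss xs; rewrite (path_component sss xs).
apply/ordersP; split=> [|y|]; [exact: path_uniq | by rewrite inE |].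
apply/setP => e; rewrite inE; apply/idP/andP => [es|[ea /subsetP es]].
  split; first by rewrite alphaE; apply/mem_bigcup_seq; exists s.
  by apply/subsetP => z ze; rewrite inE (path_edges_mem es).
move: (ea); rewrite alphaE => /mem_bigcup_seq[t tss et].
have /card_gt0P[z ze] : 0 < #|e| by rewrite (path_edges_card (path_uniq tss) et).
have zs : z \in s by have := es z ze; rewrite inE.
exact: edges_unique_path sss zs ea ze.
Qed.

End Decomposition.

Lemma perm_flatten_blocks (P : {set {set U}}) I (f : {set U} -> seq U) :
  partition P I -> (forall B, B \in P -> perm_eq (f B) (enum B)) ->
  perm_eq (flatten [seq f B | B <- enum P]) (enum I).
Proof.
case/and3P=> /eqP <- /trivIsetP tP P0 fP; apply/allP => x _ /=; apply/eqP.
rewrite count_flatten -map_comp sumnE big_map big_enum /=.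
rewrite (eq_bigr (fun B : {set U} => (x \in B : nat))); last first.
  move=> B BP; rewrite (permP (fP _ BP)).
  by rewrite count_uniq_mem ?enum_uniq // mem_enum.
rewrite count_uniq_mem ?enum_uniq // mem_enum.
case: bigcupP => [[B BP xB]|nx].
  rewrite (bigD1 B) //= xB big1 ?addn0 // => C /andP[CP CB].
  apply/eqP; rewrite eqb0; apply/negP => xC.
  by have /pred0P/(_ x) := tP _ _ CP BP CB; rewrite /= xB xC.
by rewrite big1 // => B BP; apply/eqP; rewrite eqb0; apply/negP => xB; case: nx; exists B.
Qed.

Lemma pathsetP I alpha : reflect
  (exists2 ss, perm_eq (flatten ss) (enum I)
     & alpha = \bigcup_(s <- ss) path_edges s)
  (is_pathset I alpha).
Proof.
apply: (iffP andP) => [[/forall_inP g /forall_inP c]|[ss pss aE]]; last first.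
  have uss : uniq (flatten ss) by rewrite (perm_uniq pss) enum_uniq.
  have mss x : (x \in flatten ss) = (x \in I) by rewrite (perm_mem pss) mem_enum.
  split; [apply/forall_inP => e | apply/forall_inP => x].
    rewrite aE => /mem_bigcup_seq[s sss es].
    rewrite (path_edges_card (path_uniq uss sss) es) eqxx /=.
    apply/subsetP => x xe; rewrite -mss; apply/flattenP; exists s => //.
    exact: path_edges_mem xe.
  rewrite -mss => /flattenP[s sss xs].
  by have := path_orders uss aE sss xs; case: orders.
set P := [set component alpha x | x in I].
have compE x y : y \in component alpha x -> component alpha y = component alpha x.
  rewrite inE => xy; apply/setP => z; rewrite !inE.
  by apply/esym/same_connect => //; exact: connect_adjC.
have selfC x : x \in component alpha x by rewrite inE connect0.
have partP : partition P I.
  apply/and3P; split.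
  - rewrite eqEsubset; apply/andP; split; apply/subsetP => x.
      case/bigcupP=> B /imsetP[y yI ->]; rewrite inE => yx.
      have clI : closed (adj alpha) (mem I).
        move=> a b ab; case/andP: (g _ ab) => _ /subsetP s.
        by rewrite /= !s ?set21 ?set22.
      by rewrite -(closed_connect clI yx).
    by move=> xI; apply/bigcupP; exists (component alpha x); rewrite ?imset_f.
  - apply/trivIsetP => _ _ /imsetP[x _ ->] /imsetP[y _ ->].
    apply: contraNT => /pred0Pn[z /andP[/= zx zy]].
    by rewrite -(compE _ _ zx) -(compE _ _ zy).
  - by apply/imsetP => -[x _ /setP/(_ x)]; rewrite selfC inE.
pose f C := head [::] (orders alpha C).
have fP B : B \in P -> f B \in orders alpha B.
  by case/imsetP=> x xI ->; move: (c x xI); rewrite /f; case: orders => // *; exact: mem_head.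
exists [seq f B | B <- enum P].
  apply: perm_flatten_blocks => // B /fP; rewrite mem_filter mem_permutations.
  by case/andP.
apply/setP => e; apply/idP/mem_bigcup_seq => [ea|[s /mapP[B]]]; last first.
  rewrite mem_enum => /fP/ordersP[_ _ E] ->; rewrite E inE.
  by case/andP.
case/andP: (g _ ea) => /cards2P[x [y [_ eE]]] /subsetP sI.
have xI : x \in I by rewrite sI // eE set21.
have CP : component alpha x \in P by rewrite imset_f.
exists (f (component alpha x)); first by apply: map_f; rewrite mem_enum.
case/ordersP: (fP _ CP) => _ _ ->; rewrite inE ea eE /=.
apply/subsetP => z; rewrite !inE => /orP[/eqP->|/eqP->]; first exact: connect0.
by apply: connect1; rewrite /adj -eE.
Qed.

Lemma is_pathset_product S T alpha beta : [disjoint S & T] ->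
  is_pathset S alpha -> is_pathset T beta -> is_pathset (S :|: T) (alpha :|: beta).
Proof.
move=> dST /pathsetP[ss ps ->] /pathsetP[tt pt ->].
apply/pathsetP; exists (ss ++ tt); last by rewrite big_cat.
rewrite flatten_cat; apply: perm_trans (perm_cat ps pt) _.
apply: uniq_perm => [||x]; [|exact: enum_uniq|]; last first.
  by rewrite mem_cat !mem_enum inE.
rewrite cat_uniq !enum_uniq andbT /=; apply/hasPn => x; rewrite !mem_enum => xT.
by move: dST; rewrite disjoint_sym => /disjointFr->.
Qed.

Lemma is_pathset_shortcut I alpha S : S \subset I ->
  is_pathset I alpha -> is_pathset S (shortcut I alpha S).
Proof.
move=> SI /pathsetP[ss pss aE].
have uss : uniq (flatten ss) by rewrite (perm_uniq pss) enum_uniq.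
have mss x : (x \in flatten ss) = (x \in I) by rewrite (perm_mem pss) mem_enum.
apply/pathsetP; exists [seq [seq y <- s | y \in S] | s <- ss].
  rewrite -filter_flatten; apply: uniq_perm.
  - exact: filter_uniq.
  - exact: enum_uniq.
  move=> x; rewrite mem_filter mss mem_enum andbC.
  by case: (boolP (x \in S)) => [/(subsetP SI)->|]; rewrite ?andbF.
rewrite big_map; apply/setP => e; apply/bigcupP/mem_bigcup_seq.
  case=> x; rewrite -mss => /flattenP[s sss xs] /mem_bigcup_seq[t to et].
  exists s => //; case/ordersP: to (path_orders uss aE sss xs) => ut mt Et.
  case/ordersP=> us ms Es.
  have [||E|E] := path_edges_inj ut us.
  - by move=> z; rewrite mt ms.
  - by rewrite Et Es.
  - by rewrite -E.
  by rewrite -path_edges_rev -filter_rev -E.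
case=> -[|x s] sss; first by rewrite inE.
have xs : x \in x :: s by rewrite mem_head.
move=> es; exists x; first by rewrite -mss; apply/flattenP; exists (x :: s).
apply/mem_bigcup_seq; exists (x :: s); last by [].
exact: (path_orders uss aE sss xs).
Qed.

Lemma induced_path T s : uniq s -> exists ss,
  [/\ flatten ss = [seq y <- s | y \in T], [::] \notin ss
    & induced (path_edges s) T = \bigcup_(t <- ss) path_edges t].
Proof.
elim: s => [|x s IH] us.
  by exists [::]; split=> //; rewrite big_nil; apply/setP => e; rewrite !inE.
case: IH => [|ss [fss nss iss]]; first by case/andP: us.
have nT e : x \notin T -> x \in e -> (e \subset T) = false.
  by move=> xT xe; apply: contraNF xT => /subsetP->.
case: s us fss iss => [|y s] us fss iss.
  exists (if x \in T then [:: [:: x]] else [::]).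
  by split; rewrite /=; case: (x \in T); rewrite // ?big_nil ?big_cons ?big_nil
    ?setU0; apply/setP => e; rewrite !inE.
have indE : induced (path_edges [:: x, y & s]) T =
    (if (x \in T) && (y \in T) then [set [set x; y]] else set0)
      :|: induced (path_edges (y :: s)) T.
  apply/setP => e; rewrite [LHS]inE path_edges_cons2 in_setU1 in_setU.
  rewrite [e \in induced _ _]inE andb_orl; congr (_ || _).
  case: eqVneq => [->|ne]; last by case: ifP; rewrite inE // (negPf ne).
  by rewrite subUset !sub1set; case: ifP; rewrite !inE ?eqxx.
case: (boolP (x \in T)) => xT in indE *; last first.
  exists ss; split=> //; first by rewrite fss /= (negPf xT).
  by rewrite indE set0U.
case: (boolP (y \in T)) => yT in indE *; last first.
  exists ([:: x] :: ss); split=> //.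
  - by rewrite /= fss /= xT.
  - by rewrite big_cons -iss indE.
case: ss fss nss iss => [|[|z r] ss] //=; rewrite yT // => -[zy fss] nss iss.
exists ((x :: y :: r) :: ss); split=> //; first by rewrite /= xT -fss.
by rewrite indE iss !big_cons zy setUA.
Qed.

Lemma is_pathset_induced I alpha T : T \subset I ->
  is_pathset I alpha -> is_pathset T (induced alpha T).
Proof.
move=> TI /pathsetP[ss pss aE].
have uss : uniq (flatten ss) by rewrite (perm_uniq pss) enum_uniq.
suff [tt ft it] : exists2 tt, flatten tt = [seq y <- flatten ss | y \in T]
    & induced alpha T = \bigcup_(t <- tt) path_edges t.
  apply/pathsetP; exists tt => //; rewrite ft.
  apply: uniq_perm; [exact: filter_uniq | exact: enum_uniq | move=> x].
  rewrite mem_filter (perm_mem pss) !mem_enum andbC.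
  by case: (boolP (x \in T)) => [/(subsetP TI)->|]; rewrite ?andbF.
rewrite {pss}aE; elim: ss uss => [|s ss IH] /=.
  by exists [::] => //; rewrite !big_nil; apply/setP => e; rewrite !inE.
rewrite cat_uniq => /and3P[us _ /IH[tt ft it]].
have [rr [fr _ ir]] := induced_path T us.
exists (rr ++ tt); first by rewrite flatten_cat filter_cat fr ft.
rewrite big_cat /= -ir -it big_cons; apply/setP => e.
by rewrite !inE andb_orl.
Qed.

End Graphs.

(* Sets of paths on I, as a basis of the I-component of the species of paths. *)
Definition pathsets (U : finType) (I : {set U}) : Type :=
  {alpha : {set {set U}} | is_pathset I alpha}.

HB.instance Definition _ (U : finType) (I : {set U}) :=
  Finite.copy (pathsets I) {alpha : {set {set U}} | is_pathset I alpha}.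

Section SetLevel.
Variable U : finType.
Implicit Types (I S T : {set U}) (Ss : seq {set U}).

Definition is_decomposition I S T : bool := (S :|: T == I) && [disjoint S & T].

Lemma product_subproof I S T (d : is_decomposition I S T)
    (alpha : pathsets S) (beta : pathsets T) :
  is_pathset I (val alpha :|: val beta).
Proof.
case/andP: d => /eqP <- dST.
exact: is_pathset_product dST (valP alpha) (valP beta).
Qed.

Lemma shortcut_subproof I S T (d : is_decomposition I S T) (alpha : pathsets I) :
  is_pathset S (shortcut I (val alpha) S).
Proof.
apply: is_pathset_shortcut (valP alpha).
by case/andP: d => /eqP <- _; exact: subsetUl.
Qed.

Lemma induced_subproof I S T (d : is_decomposition I S T) (alpha : pathsets I) :
  is_pathset T (induced (val alpha) T).
Proof.
apply: is_pathset_induced (valP alpha).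
by case/andP: d => /eqP <- _; exact: subsetUr.
Qed.

Lemma unit_subproof : is_pathset set0 (set0 : {set {set U}}).
Proof. by apply/pathsetP; exists [::]; rewrite ?big_nil //= enum_set0. Qed.

Definition product I S T (d : is_decomposition I S T)
    (x : pathsets S * pathsets T) : pathsets I :=
  exist _ (val x.1 :|: val x.2) (product_subproof d x.1 x.2).

Definition coproduct I S T (d : is_decomposition I S T)
    (alpha : pathsets I) : pathsets S * pathsets T :=
  (exist _ (shortcut I (val alpha) S) (shortcut_subproof d alpha),
   exist _ (induced (val alpha) T) (induced_subproof d alpha)).

Definition is_composition I Ss : bool :=
  [&& set0 \notin Ss, pairwise (fun S T => [disjoint S & T]) Ss
    & \bigcup_(S <- Ss) S == I].

Lemma composition_nil I : is_composition I [::] -> I = set0.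
Proof. by rewrite /is_composition big_nil => /and3P[_ _ /eqP]. Qed.

Lemma composition_disjoint S Ss :
  all (fun T => [disjoint S & T]) Ss -> [disjoint S & \bigcup_(T <- Ss) T].
Proof.
elim: Ss => [|T Ss IH] /=; first by rewrite big_nil -setI_eq0 setI0.
case/andP=> dT /IH; rewrite big_cons -!setI_eq0 setIUr => /eqP->.
by rewrite setU0 setI_eq0.
Qed.

Lemma composition_head I S Ss :
  is_composition I (S :: Ss) -> is_decomposition I S (I :\: S).
Proof.
rewrite /is_composition big_cons => /and3P[_ _ /eqP <-].
apply/andP; split; last by rewrite disjoint_sym disjoints_subset subsetDr.
by apply/eqP/setP => x; rewrite !inE; case: (x \in S).
Qed.

Lemma composition_tail I S Ss :
  is_composition I (S :: Ss) -> is_composition (I :\: S) Ss.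
Proof.
rewrite /is_composition big_cons inE negb_or /=.
case/and3P=> /andP[_ ->] /andP[dS ->] /eqP <- /=.
rewrite setDUl setDv set0U eq_sym; apply/eqP/setDidPl.
by rewrite disjoint_sym composition_disjoint.
Qed.

(* The tensor product of the spaces with bases pathsets S_1, ..., pathsets S_k
   has the product of these bases as a basis. *)
Fixpoint tensor_basis Ss : finType :=
  if Ss is T :: Ss' then (pathsets T * tensor_basis Ss')%type else unit.

(* The recursion stops at k = 0, where the source or target is the
   one-dimensional component at the empty set (unit and counit). *)
Fixpoint iter_coproduct Ss :
    forall I, is_composition I Ss -> pathsets I -> tensor_basis Ss :=
  match Ss with
  | [::] => fun _ _ _ => tt
  | T :: Ss' => fun I c alpha =>
      let x := coproduct (composition_head c) alpha in
      (x.1, iter_coproduct (composition_tail c) x.2)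
  end.

Fixpoint iter_product Ss :
    forall I, is_composition I Ss -> tensor_basis Ss -> pathsets I :=
  match Ss with
  | [::] => fun I c _ =>
      exist _ set0 (eq_ind_r (fun J => is_pathset J set0)
                             unit_subproof (composition_nil c))
  | T :: Ss' => fun I c x =>
      product (composition_head c) (x.1, iter_product (composition_tail c) x.2)
  end.

End SetLevel.

Section Linear.
Local Open Scope ring_scope.
Variable K : fieldType.

Definition basis_vector (B : finType) (b : B) : {ffun B -> K^o} :=
  [ffun x => (x == b)%:R].

Definition linearize (A B : finType) (f : A -> B) (v : {ffun A -> K^o}) :
    {ffun B -> K^o} :=
  \sum_(a : A) v a *: basis_vector (f a).

(* A composition of I into nonempty sets has at most #|I| parts. *)
Definition antipode (U : finType) (I : {set U}) (v : {ffun pathsets I -> K^o}) :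
    {ffun pathsets I -> K^o} :=
  if I == set0 then v else
  \sum_(1 <= k < #|I|.+1)
    \sum_(Ss : {Ss : k.-tuple {set U} | is_composition I Ss})
      (-1) ^+ k *: linearize (iter_product (valP Ss))
                     (linearize (iter_coproduct (valP Ss)) v).

End Linear.

Section Partitions.
Variable U : finType.
Implicit Types (I S p q : {set U}) (P Q : {set {set U}}) (w : seq U).

Definition is_path I (l : pathsets I) : bool :=
  [exists x in I, component (val l) x == I].

(* In what follows w lists the vertices of a path, and the elements are compared
   through their position in w. *)
Definition noncrossing w P : bool :=
  [forall p in P, forall q in P, (p != q) ==>
    ~~ [exists a in p, exists b in q, exists c in p, exists d in q,
         [&& (index a w < index b w)%N, (index b w < index c w)%N
           & (index c w < index d w)%N]]].

Definition noncrossing_partition I w : Type :=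
  {P : {set {set U}} | partition P I && noncrossing w P}.

HB.instance Definition _ I w :=
  Finite.copy (noncrossing_partition I w)
    {P : {set {set U}} | partition P I && noncrossing w P}.

Lemma linear_graph_subproof I (l : pathsets I) w
    (lw : w \in orders (val l) I) (P : noncrossing_partition I w) :
  is_pathset I (\bigcup_(p in val P) path_edges [seq x <- w | x \in p]).
Proof.
case/andP: (valP P) => partP _; case/ordersP: lw => uw mw _.
apply/pathsetP; exists [seq [seq x <- w | x \in p] | p <- enum (val P)].
  apply: perm_flatten_blocks => // p pp; apply: uniq_perm; rewrite ?enum_uniq //.
    exact: filter_uniq.
  move=> x; rewrite mem_filter mw mem_enum andbC.
  case: (boolP (x \in p)) => xp; rewrite ?andbF // andbT.
  by rewrite -(cover_partition partP); apply/bigcupP; exists p.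
by rewrite big_map big_enum.
Qed.

Definition linear_graph I (l : pathsets I) w (lw : w \in orders (val l) I)
    (P : noncrossing_partition I w) : pathsets I :=
  exist _ (\bigcup_(p in val P) path_edges [seq x <- w | x \in p])
    (linear_graph_subproof lw P).

(* max S1 = b and min S2 = b + 1 *)
Definition adjacent_blocks w S1 S2 : bool :=
  [exists b in S1, exists b' in S2,
    [&& index b' w == (index b w).+1,
        [forall x in S1, (index x w <= index b w)%N]
      & [forall x in S2, (index b' w <= index x w)%N]]].

Definition merge_step w : rel {set {set U}} := fun P Q =>
  [exists S1 in P, exists S2 in P,
    adjacent_blocks w S1 S2
    && (Q == (S1 :|: S2) |: (P :\: [set S1; S2]))].

Definition is_adjacent_closure w P Q : bool :=
  connect (merge_step w) P Q && [forall R, ~~ merge_step w Q R].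

(* Merging always terminates (adjacent_closureP), so the default is not used. *)
Definition adjacent_closure w P : {set {set U}} :=
  odflt P [pick Q | is_adjacent_closure w P Q].

Lemma merge_step_card w P Q :
  merge_step w P Q -> (#|Q| < #|P|)%N.
Proof.
case/exists_inP=> S1 p1 /exists_inP[S2 p2 /andP[a /eqP->]].
have S12 : S1 != S2.
  apply: contraTneq a => <-; apply/negP => /exists_inP[b bS /exists_inP[c cS]].
  by case/and3P=> /eqP E /forall_inP/(_ c cS); rewrite E ltnn.
rewrite cardsU1 -(cardsID [set S1; S2] P) (setIidPr _) ?cards2 ?S12 //.
  by rewrite ltn_add2r; case: (_ \notin _).
by apply/subsetP => q; rewrite !inE => /orP[]/eqP->.
Qed.

Lemma adjacent_closureP w P : is_adjacent_closure w P (adjacent_closure w P).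
Proof.
rewrite /adjacent_closure; case: pickP => //= no.
suff [Q s] : exists Q, is_adjacent_closure w P Q by rewrite no in s.
have [n] := ubnP #|P|; elim: n P {no} => // n IH P len.
case: (boolP [forall R, ~~ merge_step w P R]) => [st|].
  by exists P; rewrite /is_adjacent_closure connect0.
case/forallPn=> R; rewrite negbK => pt.
have [|Q /andP[ts st]] := IH R.
  by apply: leq_trans (merge_step_card pt) _; rewrite -ltnS.
exists Q; rewrite /is_adjacent_closure st andbT.
exact: connect_trans (connect1 pt) ts.
Qed.

Definition catalan (n : nat) : nat := 'C(n.*2, n) %/ n.+1.

Lemma catalanE n : (catalan n * n.+1)%N = 'C(n.*2, n).
Proof.
apply: divnK; case: n => // n.
have E : (n.+2 * 'C(n.+1.*2, n.+2) = n.+1 * 'C(n.+1.*2, n.+1))%N.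
  have := mul_bin_left n.+1.*2 n.+1.
  by rewrite -[X in (X - _)%N]addnn addnK.
have -> : 'C(n.+1.*2, n.+1) = (n.+2 * ('C(n.+1.*2, n.+1) - 'C(n.+1.*2, n.+2)))%N.
  by rewrite mulnBr E -mulnBl subSnn mul1n.
exact: dvdn_mulr.
Qed.

Definition coef w P : int :=
  ((-1) ^+ #|P| *
   \prod_(p in adjacent_closure w P)
     (catalan #|[set q in P | q \subset p]|)%:Z)%R.

End Partitions.

(* An expression sum_j c_j x_j in basis elements, with integer coefficients. *)
Definition cancellation_free (J : finType) (X : eqType)
    (c : J -> int) (x : J -> X) : Prop :=
  forall i j, i != j -> x i = x j -> ~~ (c i * c j < 0)%R.

Definition grouping_free (J : finType) (X : eqType) (x : J -> X) : Prop :=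
  forall i j, i != j -> x i != x j.

(* Main.v *)
Require Import Defs.
From mathcomp Require Import all_boot all_order all_algebra.
From mathcomp Require Import zify ring.
Set Implicit Arguments.
Unset Strict Implicit.
Unset Printing Implicit Defensive.
Import Order.TTheory GRing.Theory Num.Theory.

(** A term of the antipode is given by a composition S_1, ..., S_k of I. On the
path l it produces the paths on the blocks of a partition: two vertices are in
the same block when they are in the same S_i and no vertex between them is in
an earlier part ([composition_blocks], [iter_antipode_term]). This partition is
noncrossing ([composition_blocks_good]), so the coefficient of l(pi) is the
number of compositions that produce pi, each counted with the sign (-1)^k.

The signed count is computed by splitting off the first part. What remains of l
is then its induced subgraph on a subset T of I, whose paths are the runs of T,
that is the maximal sets of consecutive vertices that stay in T; so the
induction is over all subsets T and all partitions P of T that refine the runs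
([good]). The first part S meets each run of T in nothing, or in one block of P
that is not nested inside another block (an outer block). The signed count is
therefore minus the sum, over the nonempty S of this kind, of the counts for P
without the blocks of S. Hence the formula follows if the sum of the claimed
coefficients over all such S, the empty one included, is zero
([removable_sum]).

To see this, fix the first run R of T and the part of S outside R. Then S meets
R in nothing or in one of the outer blocks p_1, ..., p_m of R. These are
consecutive, p_(i+1) starting right after the end of p_i, so they form a single
block of the adjacent closure and contribute the factor C_m ([outer_chain]).
Removing p_j cuts this block into pieces of j-1 and m-j blocks, leaves the rest
of the closure as it is, and changes the sign. The terms cancel by the
recursion C_m = sum_j C_(j-1) C_(m-j) ([catalan_conv], [chain_weight_remove]).

Comparing closures before and after a removal is easy once the closure is known
to consist of the classes of the equivalence relation generated by being in
the same block or in adjacent blocks ([adjacent_closureE]): its weight is then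
multiplicative over sets of blocks without adjacencies between them
([chain_weightD]).

The blocks of pi are the connected components of l(pi), so different partitions
give different graphs ([block_graph_inj]). This is grouping-freeness, which
leaves nothing to cancel. *)

(** * The Catalan recursion *)

Section Catalan.
Local Open Scope ring_scope.

Lemma central_binS i :
  (i.+1 * 'C(i.+1.*2, i.+1) = (i.*2.+1).*2 * 'C(i.*2, i))%N.
Proof.
have E1 := mul_bin_diag (i.+1.*2) i; rewrite doubleS /= in E1 *.
have E2 := mul_bin_diag (i.*2.+1) i; rewrite /= in E2.
have E3 : 'C(i.*2.+1, i.+1) = 'C(i.*2.+1, i).
  by rewrite -[LHS]bin_sub; [congr 'C(_, _); lia | lia].
rewrite E3 in E2; apply/eqP; rewrite -(eqn_pmul2l (ltn0Sn i)); apply/eqP.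
rewrite -E1; nia.
Qed.

Local Notation cbin i := ('C(i.*2, i)%:R : rat).

Lemma cbinS i : cbin i.+1 = (i%:R *+ 2 + 1) *+ 2 / (i%:R + 1) * cbin i.
Proof.
have h : (i%:R + 1 : rat) != 0 by rewrite natr1 pnatr_eq0.
apply: (mulfI h); rewrite natr1 -natrM central_binS -!muln2 !natrM -!natr1 natrM.
by field.
Qed.

Lemma catalan_ratE i : (catalan i)%:R = cbin i / (i%:R + 1) :> rat.
Proof.
have h : (i%:R + 1 : rat) != 0 by rewrite natr1 pnatr_eq0.
by apply: (mulIf h); rewrite mulfVK // -catalanE natrM natr1.
Qed.

(** A telescoping sum found by Gosper's algorithm: the summand is the difference
of consecutive values of [g] below, because consecutive central binomial
coefficients have a rational ratio. *)
Lemma catalan_conv m :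
  (catalan m.+1 = \sum_(j < m.+1) catalan j * catalan (m - j))%N.
Proof.
pose g (j : nat) : rat := cbin j * cbin (m.+1 - j) * (j%:R *+ 2 - m%:R - 1)
  / ((m%:R + 1) * (m%:R + 2%:R)) / 2%:R.
apply/eqP; rewrite -(eqr_nat rat) natr_sum.
have -> : \sum_(j < m.+1) (catalan j * catalan (m - j))%:R = g m.+1 - g 0 :> rat.
  rewrite -telescope_sumr // big_mkord; apply: eq_bigr => -[j /= lt_jm] _.
  rewrite natrM !catalan_ratE /g subSS cbinS (_ : m.+1 - j = (m - j).+1)%N; last lia.
  rewrite cbinS.
  have [k mE] : exists k, m = (j + k)%N by exists (m - j)%N; lia.
  rewrite mE addKn natrD; field.
  by rewrite -!natrD !natr1 !pnatr_eq0 addnS.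
rewrite catalan_ratE /g subnn subn0 double0 bin0 -natr1; apply/eqP; field.
by rewrite -?natrD ?natr1 ?pnatr_eq0 ?addnS.
Qed.

End Catalan.

(** * Adjacent closures *)

Section Adjacency.
Variables (U : finType) (w : seq U).
Implicit Types (p q : {set U}) (x y z b : U) (P Q X : {set {set U}}).
Local Notation pos x := (index x w).
Local Notation adjb := (adjacent_blocks w).

Lemma adjacent_blocksP p q : reflect
  (exists b b', [/\ b \in p, b' \in q, pos b' = (pos b).+1,
     {in p, forall x, pos x <= pos b} & {in q, forall x, pos b' <= pos x}])
  (adjb p q).
Proof.
apply: (iffP exists_inP) => [[b bp /exists_inP[b' bq]]|[b [b' [bp bq E mx mn]]]].
  case/and3P=> /eqP E /forall_inP mx /forall_inP mn; exists b, b'; split=> //.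
exists b => //; apply/exists_inP; exists b' => //; rewrite E eqxx /=.
by apply/andP; split; apply/forall_inP => // x /mn; rewrite E.
Qed.

Lemma adjacent_lt p q x y : adjb p q -> x \in p -> y \in q -> pos x < pos y.
Proof. case/adjacent_blocksP=> b [b' [_ _ E mx mn]] /mx ? /mn ?; lia. Qed.

(** This lemma and the next say that merging does not destroy other adjacencies:
the union of two adjacent blocks ends where the second one ends and starts
where the first one starts. *)
Lemma adjacentUl (S1 S2 : {set U}) q : adjb S1 S2 -> adjb S2 q -> adjb (S1 :|: S2) q.
Proof.
move=> a12 /adjacent_blocksP[b [b' [bp bq E mx mn]]]; apply/adjacent_blocksP.
exists b, b'; split=> // [|x]; first by rewrite inE bp orbT.
by rewrite inE => /orP[x1|/mx //]; apply/ltnW/(adjacent_lt a12 x1 bp).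
Qed.

Lemma adjacentUr p (S1 S2 : {set U}) : adjb S1 S2 -> adjb p S1 -> adjb p (S1 :|: S2).
Proof.
move=> a12 /adjacent_blocksP[b [b' [bp bq E mx mn]]]; apply/adjacent_blocksP.
exists b, b'; split=> // [|x]; first by rewrite inE bq.
by rewrite inE => /orP[/mn //|x2]; apply/ltnW/(adjacent_lt a12 bq x2).
Qed.

Lemma index_inj_mem x y : x \in w -> pos x = pos y -> x = y.
Proof.
move=> xw E; have yw : y \in w by rewrite -index_mem -E index_mem.
by rewrite -(nth_index x xw) E nth_index.
Qed.

Section Partition.
Variables (P : {set {set U}}) (D : {set U}).
Hypotheses (partP : partition P D) (Dw : {subset D <= w}).

Lemma block_eq p q x : p \in P -> q \in P -> x \in p -> x \in q -> p = q.
Proof.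
case/and3P: partP => _ tP _ pP qP xp xq.
by rewrite -(def_pblock tP pP xp) (def_pblock tP qP xq).
Qed.

Lemma block_mem p x : p \in P -> x \in p -> x \in D.
Proof. by move=> pP xp; rewrite -(cover_partition partP); apply/bigcupP; exists p. Qed.

Lemma adjacent_right p q q' :
  q \in P -> q' \in P -> adjb p q -> adjb p q' -> q = q'.
Proof.
move=> qP qP' /adjacent_blocksP[b [c [bp cq E mx _]]].
case/adjacent_blocksP=> b' [c' [bp' cq' E' mx' _]].
have cc' : c = c'.
  apply: index_inj_mem; first by apply/Dw/(block_mem qP).
  by rewrite E E'; apply/eqP; rewrite eqSS eqn_leq mx' ?mx.
by apply: (block_eq qP qP' cq); rewrite cc'.
Qed.

Lemma adjacent_left p p' q :
  p \in P -> p' \in P -> adjb p q -> adjb p' q -> p = p'.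
Proof.
move=> pP pP' /adjacent_blocksP[b [c [bp cq E _ mn]]].
case/adjacent_blocksP=> b' [c' [bp' cq' E' _ mn']].
have bb' : b = b'.
  apply: index_inj_mem; first by apply/Dw/(block_mem pP).
  by apply/eqP; rewrite -eqSS -E -E' eqn_leq mn' ?mn.
by apply: (block_eq pP pP' bp); rewrite bb'.
Qed.

End Partition.

(** On a partition, the equivalence relation that [linked] generates does not
change under a merge, and at the end of all merges it is the relation of being
in the same block. This is what makes the adjacent closure computable without
following the merges. *)
Definition linked P : rel U := fun x y =>
  [exists p in P, exists q in P,
    [&& x \in p, y \in q & [|| p == q, adjb p q | adjb q p]]].

Lemma linkedP P x y : reflect
  (exists p q, [/\ p \in P, q \in P, x \in p, y \in q
                 & [|| p == q, adjb p q | adjb q p]])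
  (linked P x y).
Proof.
apply: (iffP exists_inP) => [[p pP /exists_inP[q qP /and3P[xp yq a]]]|].
  by exists p, q.
case=> p [q [pP qP xp yq a]]; exists p => //; apply/exists_inP; exists q => //.
exact/and3P.
Qed.

Lemma linkedC P x y : linked P x y = linked P y x.
Proof.
by apply/linkedP/linkedP => -[p [q [pP qP xp yq a]]]; exists q, p; split=> //;
  rewrite eq_sym [adjb q p || _]orbC.
Qed.

Lemma connect_linkedC P : connect_sym (linked P).
Proof. exact: sym_connect_sym (@linkedC P). Qed.

Section MergeStep.
Variables (P : {set {set U}}) (D S1 S2 : {set U}).
Hypotheses (partP : partition P D) (Dw : {subset D <= w}).
Hypotheses (S1P : S1 \in P) (S2P : S2 \in P) (a12 : adjb S1 S2).

Let f p := if p \in [set S1; S2] then S1 :|: S2 else p.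
Let Q := (S1 :|: S2) |: (P :\: [set S1; S2]).

Let QE : Q = f @: P.
Proof.
apply/setP => q; apply/setU1P/imsetP => [[->|/setDP[qP nq]]|[p pP ->]].
- by exists S1; rewrite // /f !inE eqxx.
- by exists q; rewrite // /f (negPf nq).
by rewrite /f; case: ifPn => [|np]; [left | right; rewrite inE np].
Qed.

Let sub_f p : p \subset f p.
Proof. by rewrite /f !inE; do 2?case: eqVneq => [->|_]; rewrite ?subsetUl ?subsetUr. Qed.

Let f_sub p x : p \in P -> x \in f p -> exists p', [/\ p' \in P, x \in p' & f p' = f p].
Proof.
move=> pP; rewrite {1}/f; case: ifP => [p12|np xp]; last by exists p.
by rewrite inE => /orP[x1|x2]; [exists S1|exists S2]; rewrite /f p12 !inE eqxx ?orbT.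
Qed.

Let linked_f p x y : p \in P -> x \in f p -> y \in f p -> linked P x y.
Proof.
move=> pP; rewrite /f; case: ifP => [p12|np xp yp]; last first.
  by apply/linkedP; exists p, p; rewrite eqxx.
rewrite !inE => /orP[]xS /orP[]yS; apply/linkedP.
- by exists S1, S1; rewrite eqxx.
- by exists S1, S2; rewrite a12 orbT.
- by exists S2, S1; rewrite a12 !orbT.
- by exists S2, S2; rewrite eqxx.
Qed.

Let adjacent_f p q : p \in P -> q \in P -> adjb p q -> f p = f q \/ adjb (f p) (f q).
Proof.
move=> pP qP a; rewrite /f !inE.
have [p1|np1] /= := eqVneq p S1.
  rewrite p1 in a; have -> := adjacent_right partP Dw qP S2P a a12.
  by rewrite eqxx orbT; left.
have [q2|nq2] /= := eqVneq q S2.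
  by case/eqP: np1; rewrite q2 in a; apply: (adjacent_left partP Dw pP S1P a a12).
rewrite orbF; have [p2|np2] /= := eqVneq p S2.
  have [q1|nq1] /= := eqVneq q S1; first by left.
  by right; apply: adjacentUl => //; rewrite -p2.
have [q1|nq1] /= := eqVneq q S1; last by right.
by right; apply: adjacentUr => //; rewrite -q1.
Qed.

Lemma merge_partition : partition Q D.
Proof.
rewrite QE; apply/and3P; split.
- rewrite -(cover_partition partP) eqEsubset; apply/andP; split; apply/subsetP => x.
    case/bigcupP=> _ /imsetP[p pP ->] /(f_sub pP)[p' [pP' xp' _]].
    by apply/bigcupP; exists p'.
  case/bigcupP=> p pP xp; apply/bigcupP; exists (f p); first exact: imset_f.
  exact: (subsetP (sub_f p)).
- apply/trivIsetP => _ _ /imsetP[p pP ->] /imsetP[q qP ->].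
  apply: contraNT => /pred0Pn[x /andP[/= /(f_sub pP)[p' [pP' xp <-]]]].
  by move=> /(f_sub qP)[q' [qP' xq <-]]; rewrite (block_eq partP pP' qP' xp xq).
- apply/imsetP => -[p pP p0]; case/and3P: partP => _ _ /negP[].
  by have := sub_f p; rewrite -p0 subset0 => /eqP <-.
Qed.

(** The merge replaces the block [p] by [f p]. Adjacent blocks have adjacent or
equal images, because a block has at most one neighbour on each side;
conversely the ends at which two images meet already belong to adjacent blocks
of [P], and all elements of an image are linked in [P]. *)
Lemma merge_connect : connect (linked P) =2 connect (linked Q).
Proof.
suff [PQ QP] : subrel (linked P) (connect (linked Q)) /\
    subrel (linked Q) (connect (linked P)).
  by move=> x y; apply/idP/idP; apply: connect_sub.
rewrite QE; split=> x y.
  case/linkedP=> p [q [pP qP xp yq a]]; apply/connect1/linkedP; exists (f p), (f q).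
  split; rewrite ?imset_f //; [exact: (subsetP (sub_f p)) | exact: (subsetP (sub_f q)) |].
  case/or3P: a => [/eqP->|a|a]; first by rewrite eqxx.
    by case: (adjacent_f pP qP a) => ->; rewrite ?eqxx ?orbT.
  by case: (adjacent_f qP pP a) => ->; rewrite ?eqxx ?orbT.
have H p q u v : p \in P -> q \in P -> u \in f p -> v \in f q -> adjb (f p) (f q) ->
    connect (linked P) u v.
  move=> pP qP up vq /adjacent_blocksP[b [b' [bp bq E mx mn]]].
  have [p' [pP' bp' fp']] := f_sub pP bp; have [q' [qP' bq' fq']] := f_sub qP bq.
  apply: connect_trans (connect1 (linked_f pP up bp)) _.
  apply: connect_trans _ (connect1 (linked_f qP bq vq)); apply/connect1/linkedP.
  exists p', q'; split=> //; suff -> : adjb p' q' by rewrite orbT.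
  apply/adjacent_blocksP; exists b, b'; split=> // z zp.
    by apply: mx; rewrite -fp' (subsetP (sub_f p')).
  by apply: mn; rewrite -fq' (subsetP (sub_f q')).
case/linkedP=> _ [_ [/imsetP[p pP ->] /imsetP[q qP ->] xp yq /or3P[/eqP E|a|a]]].
- by rewrite E in xp; apply/connect1/(linked_f qP).
- exact: H a.
- by rewrite connect_linkedC; apply: H a.
Qed.

End MergeStep.

Lemma merge_step_linked P Q (D : {set U}) : {subset D <= w} -> merge_step w P Q ->
  partition P D -> partition Q D /\ connect (linked P) =2 connect (linked Q).
Proof.
move=> Dw /exists_inP[S1 S1P /exists_inP[S2 S2P /andP[a /eqP->]]] partP.
by split; [apply: merge_partition | apply: (merge_connect partP)].
Qed.

Lemma eq_equivalence_partition (R R' : rel U) (D : {set U}) :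
  {in D &, R =2 R'} -> equivalence_partition R D = equivalence_partition R' D.
Proof.
move=> RR'; apply: eq_in_imset => x xD; apply/setP => y; rewrite !inE.
by case: (boolP (y \in D)) => //= yD; rewrite RR'.
Qed.

(** The generated relation is invariant along the merges, and in a terminal
partition linked elements share a block. *)
Lemma adjacent_closureE P (D : {set U}) : {subset D <= w} -> partition P D ->
  adjacent_closure w P = equivalence_partition (connect (linked P)) D.
Proof.
move=> Dw; have /andP[] := adjacent_closureP w P.
move: (adjacent_closure w P) => Q /connectP[s].
elim: s P => [|R s IH] P /=; last first.
  case/andP=> PR sR QE st partP; have [partR E] := merge_step_linked Dw PR partP.
  by rewrite (IH _ sR QE st partR); apply: eq_equivalence_partition => x y _ _; rewrite E.
move=> _ -> /forallP st partP; rewrite -{1}(equivalence_partition_pblock partP).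
have na p q : p \in P -> q \in P -> adjb p q = false.
  move=> pP qP; apply/negbTE/negP => a.
  move: (st ((p :|: q) |: (P :\: [set p; q]))) => /negP[].
  by apply/exists_inP; exists p => //; apply/exists_inP; exists q; rewrite // a eqxx.
have tP := partition_trivIset partP; have cP := cover_partition partP.
apply: eq_equivalence_partition => x y xD yD; apply/idP/idP => [yx|].
  apply/connect1/linkedP; exists (pblock P x), (pblock P x).
  by rewrite pblock_mem ?mem_pblock ?cP // eqxx yx.
case/connectP=> t tx ->; elim: t x {yD} xD tx => [|z t IH] x xD /=.
  by rewrite mem_pblock cP.
case/andP=> /linkedP[p [q [pP qP xp zq]]]; rewrite !na // !orbF => /eqP pq zt.
have zp : z \in p by rewrite pq.
have := IH z (block_mem partP pP zp) zt.
by rewrite (def_pblock tP pP xp) (def_pblock tP pP zp).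
Qed.

(** Used to compare the classes of [linked P] with those of [linked] on a set of
blocks of [P] to which [P] links nothing from outside. *)
Lemma connect_restrict (e e' : rel U) (A : {set U}) x y :
  (forall u v, u \in A -> e u v -> v \in A /\ e' u v) ->
  x \in A -> connect e x y -> y \in A /\ connect e' x y.
Proof.
move=> H xA /connectP[t xt ->]; elim: t x xA xt => [|z t IH] x xA //=.
case/andP=> /(H _ _ xA)[zA xz] /(IH _ zA)[yA zy]; split=> //.
exact: connect_trans (connect1 xz) zy.
Qed.

Lemma linkedS X P : X \subset P -> subrel (linked X) (linked P).
Proof.
move=> /subsetP XP x y /linkedP[p [q [pP qP xp yq a]]].
by apply/linkedP; exists p, q; split; rewrite ?XP.
Qed.

Definition chain_weight P : nat :=
  \prod_(C in adjacent_closure w P) catalan #|[set q in P | q \subset C]|.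

Lemma coefE P : coef w P = ((-1) ^+ #|P| * (chain_weight P)%:Z)%R.
Proof. by rewrite /coef /chain_weight (big_morph Posz PoszM (erefl _)). Qed.

(** As no block of [X] is adjacent to a block outside [X], the classes of the
generated relation split into those of [X], here a single one, and those of the
other blocks. *)
Lemma chain_weightD X P (D : {set U}) : {subset D <= w} -> partition P D ->
    X \subset P ->
    (forall p q, p \in X -> q \in P :\: X -> ~~ adjb p q && ~~ adjb q p) ->
    {in cover X &, forall x y, connect (linked X) x y} ->
  chain_weight P = catalan #|X| * chain_weight (P :\: X).
Proof.
move=> Dw partP XP noadj conX; have [->|[p0 p0X]] := set_0Vmem X.
  by rewrite cards0 setD0 mul1n.
have subXP := subsetP XP; set Y := P :\: X in noadj *.
have subYP : Y \subset P := subsetDl P X.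
have XY : P = X :|: Y by rewrite setUC -[in RHS](setIidPr XP) setUC setID.
have nlink p q : p \in X -> q \in Y -> [|| p == q, adjb p q | adjb q p] = false.
  move=> pX qY; have /andP[/negPf-> /negPf->] := noadj _ _ pX qY.
  by rewrite !orbF; apply: contraTF qY => /eqP <-; rewrite inE pX.
have nlink' p q : p \in Y -> q \in X -> [|| p == q, adjb p q | adjb q p] = false.
  by move=> pY qX; rewrite eq_sym [adjb p q || _]orbC nlink.
have cD : cover P = D := cover_partition partP.
have partY : partition Y (cover Y).
  apply/and3P; split=> //; first exact: trivIsetD (partition_trivIset partP).
  by rewrite inE negb_and (partition0 partP) orbT.
have DE : D = cover X :|: cover Y by rewrite -cD {1}XY /cover bigcup_setU.
have dXY : [disjoint cover X & cover Y].
  apply/pred0P => x /=; apply/negP => /andP[/bigcupP[p pX xp] /bigcupP[q qY xq]].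
  have pq : p = q := block_eq partP (subXP _ pX) (subsetP subYP _ qY) xp xq.
  by move: qY; rewrite -pq inE pX.
have closX u v : u \in cover X -> linked P u v -> v \in cover X /\ linked X u v.
  case/bigcupP=> p pX up /linkedP[p' [q [pP qP up' vq]]].
  rewrite -(block_eq partP (subXP _ pX) pP up up') => a.
  have qX : q \in X.
    by case: (boolP (q \in X)) a => // qX; rewrite nlink // inE qX.
  by split; [apply/bigcupP; exists q | apply/linkedP; exists p, q].
have closY u v : u \in cover Y -> linked P u v -> v \in cover Y /\ linked Y u v.
  case/bigcupP=> p pY up /linkedP[p' [q [pP qP up' vq]]].
  rewrite -(block_eq partP (subsetP subYP _ pY) pP up up') => a.
  have qY : q \in Y.
    by rewrite inE qP andbT; apply: contraTN a => qX; rewrite nlink'.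
  by split; [apply/bigcupP; exists q | apply/linkedP; exists p, q].
have connX : {in cover X, forall x, [set y in D | connect (linked P) x y] = cover X}.
  move=> x xX; apply/setP => y; rewrite inE; apply/andP/idP => [[_]|yX].
    by case/(connect_restrict closX xX).
  split; first by rewrite DE inE yX.
  by apply: (connect_sub _ (conX _ _ xX yX)) => u v uv; apply/connect1/(linkedS XP).
have connY : {in cover Y, forall x, [set y in D | connect (linked P) x y]
    = [set y in cover Y | connect (linked Y) x y]}.
  move=> x xY; apply/setP => y; rewrite !inE; apply/andP/andP => [[_]|[yY xy]].
    by case/(connect_restrict closY xY).
  split; first by rewrite DE inE yY orbT.
  by apply: (connect_sub _ xy) => u v uv; apply/connect1/(linkedS subYP).
have DYw : {subset cover Y <= w} by move=> x xY; apply: Dw; rewrite DE inE xY orbT.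
have cloE : adjacent_closure w P = cover X |: adjacent_closure w Y.
  rewrite (adjacent_closureE Dw partP) (adjacent_closureE DYw partY).
  rewrite /equivalence_partition; apply/setP => C; apply/imsetP/setU1P.
    case=> x; rewrite DE inE => /orP[xX|xY] ->; rewrite -DE ?(connX x xX); first by left.
    by right; rewrite connY //; apply: imset_f.
  have nep : p0 != set0.
    by apply: contraTneq p0X => ->; apply/negP => /subXP; rewrite (partition0 partP).
  case/set0Pn: nep => z zp; have zX : z \in cover X by apply/bigcupP; exists p0.
  case=> [->|/imsetP[x xY ->]].
    by exists z; rewrite ?connX // DE inE zX.
  by exists x; rewrite -?DE ?connY // DE inE xY orbT.
have subY (C : {set U}) : C \in adjacent_closure w Y -> C \subset cover Y.
  rewrite (adjacent_closureE DYw partY) => /imsetP[x xY ->].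
  by apply/subsetP => y; rewrite inE => /andP[].
have disX p (C : {set U}) : p \in X -> p \subset C -> C \subset cover Y -> False.
  move=> pX pC CY; have : p \subset cover X :&: cover Y.
    by rewrite subsetI (subset_trans pC CY) andbT; apply: bigcup_sup.
  move: dXY; rewrite -setI_eq0 => /eqP->; rewrite subset0 => /eqP p00.
  by move: (subXP _ pX); rewrite p00 (partition0 partP).
rewrite /chain_weight cloE big_setU1 /=; last first.
  by apply/negP => /subY /(disX _ _ p0X (bigcup_sup _ p0X)).
congr (catalan #|pred_of_set _| * _).
  apply/setP => q; rewrite inE; apply/andP/idP => [[qP qX]|qX]; last first.
    by split; [apply: subXP | apply: bigcup_sup].
  apply: contraT => nqX; have qY : q \in Y by rewrite inE nqX.
  have : q \subset cover X :&: cover Y by rewrite subsetI qX; apply: bigcup_sup.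
  move: dXY; rewrite -setI_eq0 => /eqP->; rewrite subset0 => /eqP q0.
  by move: qP; rewrite q0 (partition0 partP).
apply: eq_bigr => C /subY CY; congr (catalan #|pred_of_set _|).
apply/setP => q; rewrite 2!inE; case: (boolP (q \subset C)) => qC; rewrite ?andbF ?andbT //.
rewrite inE andbC; case: (boolP (q \in P)) => //= qP.
by apply/esym/negP => /disX /(_ qC CY).
Qed.

End Adjacency.

(** * Chains of outer blocks *)

(* Discarding the membership facts first keeps the case analysis of lia small. *)
Ltac pos_lia :=
  repeat match goal with H : ?T |- _ =>
    lazymatch T with
    | is_true (leq _ _) => fail
    | is_true (andb _ _) => fail
    | is_true (orb _ _) => fail
    | is_true (negb (eq_op _ _)) => fail
    | is_true (negb (leq _ _)) => fail
    | is_true (negb (orb _ _)) => fail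
    | is_true (negb (andb _ _)) => fail
    | @eq ?A _ _ => tryif unify A nat then fail else clear H
    | or _ _ => fail
    | _ => clear H
    end end; lia.

Section Chains.
Variables (U : finType) (w : seq U).
Implicit Types (p q r : {set U}) (x y z a b c d : U) (P Q X : {set {set U}}).
Implicit Types (s t : seq {set U}) (i j : nat).
Local Notation pos x := (index x w).
Local Notation adjb := (adjacent_blocks w).

Lemma noncrossingP P : reflect
  (forall p q a b c d, p \in P -> q \in P -> a \in p -> b \in q -> c \in p ->
     d \in q -> pos a < pos b -> pos b < pos c -> pos c < pos d -> p = q)
  (noncrossing w P).
Proof.
apply: (iffP forall_inP) => [H p q a b c d pP qP ap bq cp dq ab bc cd|H p pP].
  apply: contraTeq isT => npq; have /forall_inP/(_ q qP) := H p pP.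
  rewrite npq => /exists_inP[]; exists a => //; apply/exists_inP; exists b => //.
  by apply/exists_inP; exists c => //; apply/exists_inP; exists d; rewrite // ab bc.
apply/forall_inP => q qP; apply/implyP; apply: contra => /exists_inP[a ap].
case/exists_inP=> b bq /exists_inP[c cp /exists_inP[d dq /and3P[ab bc cd]]].
by apply/eqP; apply: (H p q a b c d).
Qed.

(** The blocks that are not nested inside another one: they can be removed
without separating the elements of another block. *)
Definition outer P p : bool :=
  [forall q in P, (q != p) ==>
    [forall x in q, forall y in q, forall z in p, ~~ (pos x < pos z < pos y)]].

Lemma outerP P p : reflect
  (forall q x y z, q \in P -> x \in q -> y \in q -> z \in p ->
     pos x < pos z -> pos z < pos y -> q = p)
  (outer P p).
Proof.
apply: (iffP forall_inP) => [H q x y z qP xq yq zp xz zy|H q qP].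
  apply: contraTeq isT => nqp; have := H q qP.
  rewrite nqp => /forall_inP/(_ x xq)/forall_inP/(_ y yq)/forall_inP/(_ z zp).
  by rewrite xz zy.
apply/implyP => nqp; apply/forall_inP => x xq; apply/forall_inP => y yq.
apply/forall_inP => z zp; apply: contra nqp => /andP[xz zy]; apply/eqP.
exact: (H q x y z).
Qed.

Definition before p q : bool := [forall x in p, forall y in q, pos x < pos y].

Lemma beforeP p q : reflect {in p & q, forall x y, pos x < pos y} (before p q).
Proof.
apply: (iffP forall_inP) => [H x y xp yq|H x xp].
  by have /forall_inP/(_ y yq) := H x xp.
by apply/forall_inP => y yq; apply: H.
Qed.

Lemma chain_connect X s : {subset s <= X} -> sorted adjb s ->
  {in cover [set p in s] &, forall x y, connect (linked w X) x y}.
Proof.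
move=> sX sorted_s.
have H p t x y q : {subset p :: t <= X} -> path adjb p t -> x \in p ->
    q \in p :: t -> y \in q -> connect (linked w X) x y.
  elim: t p x => [|p' t IH] p x pX.
    rewrite inE => _ xp /eqP-> yp; apply/connect1/linkedP.
    by exists p, p; rewrite eqxx pX ?mem_head.
  rewrite [path _ _ _]/= => /andP[a pt] xp; rewrite inE => /orP[/eqP->|qt] yq.
    apply/connect1/linkedP; exists p, p.
    by rewrite eqxx pX ?mem_head.
  case/adjacent_blocksP: (a) => b [b' [_ bp' _ _ _]].
  apply: connect_trans (IH p' b' _ pt bp' qt yq); last first.
    by move=> z zt; apply: pX; rewrite inE zt orbT.
  by apply/connect1/linkedP; exists p, p'; rewrite a orbT !pX ?inE ?eqxx ?orbT.
case: s sX sorted_s => [|p s] sX /= ps x y /bigcupP[q]; rewrite inE //.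
move=> qs xq /bigcupP[r]; rewrite inE => rs yr.
have [p0|[z zp]] := set_0Vmem p.
  case: s ps sX qs rs => [|p' s]; last first.
    by rewrite /= => /andP[/adjacent_blocksP[b [b' []]]]; rewrite p0 inE.
  by rewrite !inE p0 => _ _ /eqP q0; move: xq; rewrite q0 inE.
apply: (@connect_trans _ _ z); last exact: (H p s z y r).
by rewrite connect_linkedC; exact: (H p s z x q).
Qed.

Lemma partition_sub P X (D : {set U}) :
  partition P D -> X \subset P -> partition X (cover X).
Proof.
move=> partP XP; apply/and3P; split=> //.
  exact: trivIsetS XP (partition_trivIset partP).
by apply/negP => /(subsetP XP); rewrite (partition0 partP).
Qed.

Section Interval.
Variables (P : {set {set U}}) (D : {set U}).
Hypotheses (uw : uniq w) (partP : partition P D) (Dw : {subset D <= w}).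
Hypothesis ncP : noncrossing w P.

(** Induction on the interval of positions from [i] to [j]: the block [p] of the
first vertex has a last vertex [b], and since [P] is noncrossing no other block
has vertices on both sides of [b]. So the vertices after [b] form a
shorter interval of the same kind, whose chain continues [p]. *)
Lemma hull_chain i j : j <= size w ->
  (forall z, z \in w -> i <= pos z < j -> z \in D) ->
  (forall p x y, p \in P -> x \in p -> y \in p -> i <= pos x < j -> i <= pos y < j) ->
  exists s, [/\ {subset s <= P}, sorted adjb s /\ pairwise before s,
     (forall p x, p \in s -> x \in p -> i <= pos x < j),
     (forall z, z \in w -> i <= pos z < j -> exists p a b,
        [/\ p \in s, a \in p, b \in p, pos a <= pos z & pos z <= pos b])
     & (if s is p :: _ then exists2 b, b \in p & pos b = i else True)].
Proof.
have [n] := ubnP (j - i); elim: n i => // n IH i lt_n le_j full clos.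
case: (leqP j i) => [le_ji|lt_ij].
  by exists [::]; split=> // z _; pos_lia.
have i_lt : i < size w by exact: leq_trans lt_ij le_j.
have [x0 x0w posx0] : exists2 x0, x0 \in w & pos x0 = i.
  case E: w i_lt => [//|x' w'] i_lt; rewrite -E in i_lt *.
  by exists (nth x' w i); rewrite ?mem_nth ?index_uniq.
have x0D : x0 \in D by apply: full; rewrite // posx0 leqnn.
have cP := cover_partition partP.
have [p pP x0p] : exists2 p, p \in P & x0 \in p.
  by move: x0D; rewrite -cP => /bigcupP[p]; exists p.
case: (@arg_maxnP _ x0 (mem p) (fun x => pos x) x0p) => b /= bp mx.
have /andP[le_ib lt_bj] : i <= pos b < j.
  by apply: (clos p x0 b); rewrite ?posx0 ?leqnn.
have [||q x y qP xq yq xI|s [sP [ss sb] sI sc sh]] := IH (pos b).+1 _ le_j.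
- pos_lia.
- by move=> z zw zI; apply: full => //; pos_lia.
- have yI : i <= pos y < j by apply: (clos q x y) => //; pos_lia.
  suff : ~~ (pos y <= pos b) by pos_lia.
  apply/negP => yb.
  have npq : p <> q by move=> E; have := mx x; rewrite [x \in _]/= E => /(_ xq); pos_lia.
  have ney u v : u \in p -> v \in q -> pos u != pos v.
    move=> up vq; apply/eqP => /(index_inj_mem (Dw (block_mem partP pP up))) E.
    by apply: npq; apply: (block_eq partP pP qP up); rewrite E.
  have := ney _ _ x0p yq; have := ney _ _ bp yq; rewrite posx0 => n1 n2.
  by apply: npq; apply: (noncrossingP P ncP p q x0 y b x) => //; pos_lia.
exists (p :: s); split.
- by move=> q; rewrite inE => /orP[/eqP->|/sP].
- split; last first.
    rewrite pairwise_cons sb andbT; apply/allP => q qs; apply/beforeP => x y xp yq.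
    by have := sI q y qs yq; have := mx x xp; pos_lia.
  case: s ss sh {sP sb sc} sI => //= q s -> [b' bq' pb'] sI; rewrite andbT.
  apply/adjacent_blocksP; exists b, b'; split=> // x xq.
  by have := sI q x (mem_head _ _) xq; rewrite pb'; pos_lia.
- move=> q x; rewrite inE => /orP[/eqP->|qs] xq; last by have := sI q x qs xq; pos_lia.
  by apply: (clos p x0 x); rewrite // posx0 leqnn.
- move=> z zw zI; case: (leqP (pos z) (pos b)) => zb.
    by exists p, x0, b; rewrite mem_head posx0; split=> //; pos_lia.
  have [|q [a [c [qs aq cq az zc]]]] := sc z zw; first pos_lia.
  by exists q, a, c; rewrite inE qs orbT.
by exists x0.
Qed.

Variables (i j : nat).
Hypotheses (lt_ij : i < j) (le_j : j <= size w).
Hypothesis full : forall z, z \in w -> i <= pos z < j -> z \in D.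
Hypothesis convex : forall p x y z, p \in P -> x \in p -> y \in p -> z \in w ->
  pos x <= pos z <= pos y -> i <= pos z < j -> (i <= pos x) && (pos y < j).
Hypotheses (iD : forall z, z \in D -> (pos z).+1 != i) (jD : forall z, z \in D -> pos z != j).

Definition outer_blocks : {set {set U}} :=
  [set p in P | outer P p && [forall x in p, i <= pos x < j]].

(** The chain of [hull_chain] consists of the outer blocks: any other
block in the interval has its elements strictly between two elements of a block
of the chain, and a block around an element of a chain block would cross a block
of the chain. *)
Lemma outer_chain : exists s, [/\ outer_blocks = [set p in s],
   sorted adjb s /\ pairwise before s,
   0 < size s, {subset s <= P}
   & (forall z, z \in w -> i <= pos z < j -> exists p a b,
        [/\ p \in s, a \in p, b \in p, pos a <= pos z & pos z <= pos b])].
Proof.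
have clos p x y : p \in P -> x \in p -> y \in p -> i <= pos x < j -> i <= pos y < j.
  move=> pP xp yp xI; have xw := Dw (block_mem partP pP xp).
  case: (leqP (pos x) (pos y)) => xy.
    by have := convex pP xp yp xw; pos_lia.
  by have := convex pP yp xp xw; pos_lia.
have neq p q u v : p \in P -> q \in P -> p != q -> u \in p -> v \in q -> pos u != pos v.
  move=> pP qP npq up vq; apply/eqP => /(index_inj_mem (Dw (block_mem partP pP up))) E.
  by case/eqP: npq; apply: (block_eq partP pP qP up); rewrite E.
have [s [sP [ss sb] sI sc _]] := hull_chain le_j full clos.
have sbP p q : p \in s -> q \in s -> p != q -> before p q \/ before q p.
  elim: (s) sb => // r t IH; rewrite pairwise_cons !inE => /andP[/allP br bt].
  case/orP=> [/eqP->|pt] /orP[/eqP->|qt]; rewrite ?eqxx //; last exact: IH.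
    by left; apply: br.
  by right; apply: br.
exists s; split=> //.
  apply/setP => p; rewrite !inE; apply/and3P/idP => [[pP /outerP op /forall_inP pI]|ps].
    have /set0Pn[z zp] : p != set0.
      by apply: contraTneq pP => ->; rewrite (partition0 partP).
    have [q [a [b [qs aq bq az zb]]]] := sc z (Dw (block_mem partP pP zp)) (pI z zp).
    have [<-//|nqp] := eqVneq q p.
    have n1 := neq _ _ _ _ (sP _ qs) pP nqp aq zp.
    have n2 := neq _ _ _ _ (sP _ qs) pP nqp bq zp.
    by rewrite -(op q a b z (sP _ qs) aq bq zp) //; pos_lia.
  have pP := sP _ ps; split=> //; last by apply/forall_inP => x; apply: sI.
  apply/outerP => q x y z qP xq yq zp xz zy; apply/eqP; apply: contraTT isT => nqp.
  have zw := Dw (block_mem partP pP zp); have zI := sI p z ps zp.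
  have xI : i <= pos x < j by have := convex qP xq yq zw _ zI; pos_lia.
  have [r [a [b [rs ar br ax xb]]]] := sc x (Dw (block_mem partP qP xq)) xI.
  have nc := noncrossingP P ncP.
  have [rp|nrp] := eqVneq r p.
    subst r; have n1 := neq _ _ _ _ qP pP nqp xq ar; case/eqP: nqp.
    by apply/esym/(nc p q a x z y) => //; pos_lia.
  have [/beforeP rb|/beforeP rb] := sbP _ _ rs ps nrp; last by have := rb z a zp ar; pos_lia.
  have bz := rb b z br zp; have [rq|nrq] := eqVneq r q.
    by subst r; have := rb y z yq zp; pos_lia.
  have n1 := neq _ _ _ _ (sP _ rs) qP nrq ar xq.
  have n2 := neq _ _ _ _ (sP _ rs) qP nrq br xq.
  by case/eqP: nrq; apply: (nc r q a x b y) => //; [exact: sP | pos_lia..].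
have i_lt : i < size w := leq_trans lt_ij le_j.
have [x0 x0w x0i] : exists2 x, x \in w & pos x = i.
  case E: w i_lt => [//|x' w'] i_lt; rewrite -E in i_lt *.
  by exists (nth x' w i); rewrite ?mem_nth ?index_uniq.
have [|p [a [b [ps _ _ _ _]]]] := sc x0 x0w; first by rewrite x0i leqnn.
by case: (s) ps.
Qed.

Lemma before_irr p : p \in P -> ~~ before p p.
Proof.
move=> pP; apply/negP => /beforeP b; have /set0Pn[z zp] : p != set0.
  by apply: contraTneq pP => ->; rewrite (partition0 partP).
by have := b z z zp zp; rewrite ltnn.
Qed.

Lemma chain_uniq s : {subset s <= P} -> pairwise before s -> uniq s.
Proof.
elim: s => //= p s IH sP /andP[/allP b /IH->]; last first.
  by move=> q qs; apply: sP; rewrite inE qs orbT.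
rewrite andbT; apply/negP => /b; apply/negP/before_irr.
by apply: sP; apply: mem_head.
Qed.

(** Two ways of being adjacent are to be excluded. A block nested in the chain
cannot touch the end of another block of the chain, since the hulls of the
chain blocks are disjoint; and the positions just before and just after the
interval are not in [D]. *)
Lemma outer_not_adjacent p q : p \in outer_blocks -> q \in P :\: outer_blocks ->
  ~~ adjb p q && ~~ adjb q p.
Proof.
move=> pX; have inI x : x \in p -> i <= pos x < j.
  by move: x; apply/forall_inP; move: pX; rewrite inE => /and3P[].
have [s [sE [_ sb] _ sP sc]] := outer_chain; rewrite sE in pX *; move: pX.
rewrite !inE => ps /andP[nqs qP]; have pP := sP _ ps.
(* The hull of a chain block [r] other than [p] would contain [b'] and, as [b] is
   next to [b'], also [b]. *)
have key b b' : b \in p -> b' \in q -> i <= pos b' < j ->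
    (forall x, x \in p -> pos b < pos b' -> pos x <= pos b) ->
    (forall x, x \in p -> pos b' < pos b -> pos b <= pos x) ->
    pos b' = (pos b).+1 \/ pos b = (pos b').+1 -> False.
  move=> bp bq bI mx mn E.
  have [r [a [c [rs ar cr ab bc]]]] := sc b' (Dw (block_mem partP qP bq)) bI.
  have neq x y r' : r' \in s -> x \in r' -> y \in q -> pos x != pos y.
    move=> ts xt yq; apply/eqP => /(index_inj_mem (Dw (block_mem partP (sP _ ts) xt))).
    move=> xy; subst y; case/negP: nqs.
    by rewrite -(block_eq partP (sP _ ts) qP xt yq).
  have n1 := neq _ _ _ rs ar bq; have n2 := neq _ _ _ rs cr bq.
  have [rp|nrp] := eqVneq r p.
    subst r; case: E => E; first by have := mx c cr; pos_lia.
    by have := mn a ar; pos_lia.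
  have : before p r \/ before r p.
    elim: (s) sb ps rs => // r' s' IH; rewrite pairwise_cons !inE => /andP[/allP bt bs].
    case/orP=> [/eqP E1|ps'] /orP[/eqP E2|rs']; last exact: IH.
    - by move: nrp; rewrite E1 E2 eqxx.
    - by left; rewrite E1; apply: bt.
    - by right; rewrite E2; apply: bt.
  by case=> /beforeP bf; [have := bf b a bp ar | have := bf c b cr bp]; pos_lia.
apply/andP; split; apply/negP => /adjacent_blocksP[b [b' [bp bq E mx mn]]].
  have := jD (block_mem partP qP bq); have := inI b bp.
  move=> bI nj; apply: (key b b' bp bq) => //; [pos_lia| |pos_lia|by left].
  by move=> x xp _; apply: mx.
have := iD (block_mem partP qP bp); have := inI b' bq.
move=> bI nj; apply: (key b' b bq bp) => //; [pos_lia|pos_lia| |by right].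
by move=> x xp _; apply: mn.
Qed.

(** Removing the block number [k] of a chain of [m] blocks leaves two chains, of
[k] and [m - k - 1] blocks, so this is the Catalan recursion multiplied by the
weight of the blocks outside the chain. *)
Lemma chain_weight_remove :
  chain_weight w P = \sum_(p in outer_blocks) chain_weight w (P :\ p).
Proof.
have noadj := outer_not_adjacent; have [s [XE [ss sb] s0 sP sc]] := outer_chain.
have us := chain_uniq sP sb; rewrite {}XE in noadj *.
set Y := P :\: [set p in s] in noadj *.
have sub t : {subset t <= s} -> [set p in t] \subset P.
  by move=> ts; apply/subsetP => p; rewrite inE => /ts/sP.
have cards t : uniq t -> #|[set p in t]| = size t.
  by move=> ut; rewrite cardsE; apply/card_uniqP.
have WP : chain_weight w P = catalan (size s) * chain_weight w Y.
  rewrite (chain_weightD Dw partP (sub s _)) ?cards //.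
  by apply: chain_connect => // q qs; rewrite inE.
suff WPk k : k < size s -> chain_weight w (P :\ nth set0 s k)
    = catalan k * catalan (size s - k.+1) * chain_weight w Y.
  rewrite WP (eq_bigl (mem s)); last by move=> p; rewrite inE.
  rewrite -big_uniq // (big_nth set0) big_mkord.
  under eq_bigr => k _ do rewrite WPk //.
  rewrite -big_distrl /=; congr (_ * _).
  by case: (size s) s0 => // m _; rewrite catalan_conv.
(* The two chains [s1] and [s2] left by [p] are split off one after the other. *)
move=> lt_ks; set p := nth set0 s k; set s1 := take k s; set s2 := drop k.+1 s.
have sE : s = s1 ++ p :: s2 by rewrite -drop_nth // cat_take_drop.
have size1 : size s1 = k by rewrite size_take lt_ks.
have size2 : size s2 = size s - k.+1 by rewrite size_drop.
have ps : p \in s by apply: mem_nth.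
have sub1 : {subset s1 <= s} by move=> q; apply: mem_take.
have sub2 : {subset s2 <= s} by move=> q; apply: mem_drop.
move: us; rewrite {1}sE cat_uniq /= negb_or => /and4P[us1 /andP[np1 /hasPn n12] np2 us2].
have neB q : q \in P -> exists z, z \in q.
  by move=> qP; apply/set0Pn; apply: contraTneq qP => ->; rewrite (partition0 partP).
have b12 q r : q \in s1 -> r \in s2 -> [/\ before q p, before p r & before q r].
  move=> q1 r2; move: sb; rewrite {1}sE pairwise_cat pairwise_cons allrel_consr.
  case/and3P=> /andP[/allP h1 /allrelP h12] _ /andP[/allP h2 _].
  by split; [apply: h1 | apply: h2 | apply: h12].
have noadj12 q r : q \in s1 -> r \in s2 -> ~~ adjb q r && ~~ adjb r q.
  move=> q1 r2; have [/beforeP qp /beforeP pr /beforeP qr] := b12 q r q1 r2.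
  have [z zp] := neB p (sP _ ps).
  apply/andP; split; apply/negP => /adjacent_blocksP[b [b' [bq bz E _ _]]].
    by have := qp b z bq zp; have := pr z b' zp bz; pos_lia.
  by have := qr b' b bz bq; pos_lia.
have ss1 : sorted adjb s1 by apply: take_sorted.
have ss2 : sorted adjb s2 by apply: drop_sorted.
pose X1 := [set q in s1]; pose X2 := [set q in s2].
have part1 := partitionD1 partP (sP _ ps).
have X1P : X1 \subset P :\ p.
  apply/subsetP => q; rewrite !inE => q1; rewrite sP ?sub1 // andbT.
  by apply: contraNneq np1 => <-.
have Y1E : P :\ p :\: X1 = X2 :|: Y.
  apply/setP => q; rewrite !inE {1}sE mem_cat inE.
  have [q1|nq1] /= := boolP (q \in s1); last first.
    have [->|nqp] /= := eqVneq q p; first by rewrite (negPf np2).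
    by have [/sub2/sP->|] := boolP (q \in s2).
  by rewrite (contraTF (n12 q)) //; apply/negPn.
have X2Y : X2 \subset P :\ p :\: X1 by rewrite Y1E subsetUl.
have YE : P :\ p :\: X1 :\: X2 = Y.
  rewrite Y1E setDUl setDv set0U; apply/setDidPl.
  by rewrite disjoint_sym disjoints_subset; apply/subsetP => q; rewrite !inE => /sub2->.
have part2 : partition (P :\ p :\: X1) (cover (P :\ p :\: X1)).
  exact: partition_sub part1 (subsetDl _ _).
have D1w : {subset D :\: p <= w} by move=> x; rewrite inE => /andP[_ /Dw].
have D2w : {subset cover (P :\ p :\: X1) <= w}.
  move=> x /bigcupP[q]; rewrite inE => /andP[_ qP] xq.
  by apply: D1w; exact: (block_mem part1 qP xq).
rewrite (chain_weightD D1w part1 X1P); first last.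
- by apply: chain_connect => // q qs; rewrite inE.
- move=> q r; rewrite inE Y1E !inE => q1 /orP[r2|rY]; first exact: noadj12.
  by apply: noadj; rewrite inE ?sub1 // inE; apply: rY.
rewrite (chain_weightD D2w part2 X2Y); first last.
- by apply: chain_connect => // q qs; rewrite inE.
- by move=> q r; rewrite inE YE => q2 rY; apply: noadj; rewrite // inE sub2.
by rewrite YE !cards // size1 size2 mulnA.
Qed.

End Interval.
End Chains.

(** * The partition produced by a composition *)

Section Runs.
Variables (U : finType) (w : seq U).
Implicit Types (p q r S T : {set U}) (x y z a b c d : U) (P Q X : {set {set U}}).
Implicit Types (Ss : seq {set U}).
Local Notation pos x := (index x w).

(** The vertex set of the path through [x] in the subgraph of the path [w]
induced on [T]; it is expressed by positions because the arguments about crossings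
compare positions, and identified with the component in [component_run]. *)
Definition run T x : {set U} :=
  [set y in w | [forall z in w,
     (minn (pos x) (pos y) <= pos z <= maxn (pos x) (pos y)) ==> (z \in T)]].

Lemma runP T x y : reflect
  (y \in w /\ forall z, z \in w ->
     (pos x <= pos z <= pos y) || (pos y <= pos z <= pos x) -> z \in T)
  (y \in run T x).
Proof.
rewrite inE; apply: (iffP andP) => -[yw H]; split=> //.
  move=> z zw zI; have /implyP := forall_inP H z zw; apply; pos_lia.
by apply/forall_inP => z zw; apply/implyP => zI; apply: H => //; pos_lia.
Qed.

Lemma run_sub T x : run T x \subset T.
Proof. by apply/subsetP => y /runP[yw H]; apply: H => //; rewrite leqnn /=; pos_lia. Qed.

Lemma run_refl T x : {subset T <= w} -> x \in T -> x \in run T x.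
Proof.
move=> Tw xT; apply/runP; split; first exact: Tw.
move=> z zw zI; rewrite (@index_inj_mem _ w z x) //; pos_lia.
Qed.

Lemma run_sym T x y : x \in w -> y \in run T x -> x \in run T y.
Proof. by move=> xw /runP[yw H]; apply/runP; split=> // z zw zI; apply: H => //; pos_lia. Qed.

Lemma run_trans T x y z : y \in run T x -> z \in run T y -> z \in run T x.
Proof.
move=> /runP[yw H] /runP[zw H']; apply/runP; split=> // u uw uI.
case: (boolP ((pos x <= pos u <= pos y) || (pos y <= pos u <= pos x))) => [/H|]; first exact.
by move=> nI; apply: H' => //; pos_lia.
Qed.

Lemma run_eq T x y : x \in w -> y \in run T x -> run T y = run T x.
Proof.
move=> xw xy; apply/setP => z; apply/idP/idP; first exact: run_trans.
exact/run_trans/run_sym.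
Qed.

Lemma runS T T' x : T \subset T' -> run T x \subset run T' x.
Proof.
move=> /subsetP TT'; apply/subsetP => y /runP[yw H]; apply/runP; split=> // z zw zI.
exact/TT'/H.
Qed.

(** The vertex sets of the paths to which the coproduct restricts, on the part
[S], the subgraph induced on [T]. *)
Definition run_blocks T S : {set {set U}} :=
  equivalence_partition (fun x y => y \in run T x) S.

Lemma run_blocksP T S p : {subset S <= T} -> reflect
  (exists2 x, x \in S & p = S :&: run T x) (p \in run_blocks T S).
Proof.
by move=> ST; apply: (iffP imsetP) => -[x xS ->]; exists x => //;
  apply/setP => y; rewrite in_setI [LHS]inE || rewrite in_setI [RHS]inE.
Qed.

Lemma run_blocks_partition T S : {subset T <= w} -> {subset S <= T} ->
  partition (run_blocks T S) S.
Proof.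
move=> Tw ST; apply: equivalence_partitionP => x y z xS yS zS.
have [/ST xT /ST zT] := (xS, zS); split; first exact: (run_refl Tw zT).
by move=> xy; rewrite (run_eq (Tw _ xT) xy).
Qed.

Lemma partition_disjointU P Q S T : partition P S -> partition Q T ->
  [disjoint S & T] -> partition (P :|: Q) (S :|: T).
Proof.
move=> pP pQ dST; have cross p q : p \in P -> q \in Q -> [disjoint p & q].
  move=> /(partitionS pP) pS /(partitionS pQ) qT.
  exact: disjointWl pS (disjointWr qT dST).
apply/and3P; split.
- rewrite (_ : cover _ = cover P :|: cover Q); last exact: bigcup_setU.
  by rewrite (cover_partition pP) (cover_partition pQ).
- apply/trivIsetP => p q; rewrite !inE => /orP[]pX /orP[]qX npq.
  + exact: (trivIsetP (partition_trivIset pP)).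
  + exact: cross.
  + by rewrite disjoint_sym; apply: cross.
  + exact: (trivIsetP (partition_trivIset pQ)).
- by rewrite inE !(partition0 pP, partition0 pQ).
Qed.

Lemma partition_setD P X T : partition P T -> X \subset P ->
  partition (P :\: X) (T :\: cover X).
Proof.
move=> pP XP; rewrite (_ : T :\: cover X = cover (P :\: X)).
  exact: (partition_sub pP (subsetDl _ _)).
apply/setP => x; rewrite inE; apply/andP/bigcupP => [[xX]|[p]].
  rewrite -(cover_partition pP) => /bigcupP[p pT xp]; exists p => //.
  by rewrite inE pT andbT; apply: contra xX => pX; apply/bigcupP; exists p.
rewrite inE => /andP[npX pT] xp; split; last exact: (block_mem pP pT xp).
apply: contra npX => /bigcupP[q qX xq].
by rewrite (block_eq pP pT (subsetP XP _ qX) xp xq).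
Qed.

(** Two partitions of disjoint sets have no block in common, so that the union
determines the second partition from the first one. *)
Lemma partition_setU_inj P P' Q S T : partition P S -> partition P' T ->
  [disjoint S & T] -> (P :|: P' == Q) = (P \subset Q) && (P' == Q :\: P).
Proof.
move=> pP pP' dST; have PP' : [disjoint P & P'].
  apply/pred0P => p /=; apply/negP => /andP[p1 p2].
  have /set0Pn[x xp] : p != set0 by apply: contraTneq p1 => ->; rewrite (partition0 pP).
  by move/pred0P/(_ x): dST; rewrite /= (block_mem pP p1 xp) (block_mem pP' p2 xp).
apply/eqP/andP => [<-|[PQ /eqP->]].
  rewrite subsetUl setDUl setDv set0U; split=> //; rewrite eq_sym.
  by apply/eqP/setDidPl; rewrite disjoint_sym.
apply/setP => p; rewrite !inE.
by case: (boolP (p \in P)) => //= /(subsetP PQ)->.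
Qed.

(** The partitions that compositions of [T] produce; the last condition says that
nothing outside [T] lies between two elements of a block. *)
Definition good T P : bool :=
  [&& partition P T, noncrossing w P
    & [forall p in P, forall x in p, p \subset run T x]].

Lemma goodP T P : reflect
  [/\ partition P T, noncrossing w P
    & forall p x y, p \in P -> x \in p -> y \in p -> y \in run T x]
  (good T P).
Proof.
apply: (iffP and3P) => -[partP nc H]; split=> //.
  move=> p x y pP xp; move/forall_inP/(_ p pP)/forall_inP/(_ x xp)/subsetP: H.
  exact.
apply/forall_inP => p pP; apply/forall_inP => x xp; apply/subsetP => y.
exact: H.
Qed.

Fixpoint composition_blocks T Ss : {set {set U}} :=
  if Ss is A :: Ss' then run_blocks T A :|: composition_blocks (T :\: A) Ss'
  else set0.

Lemma composition_cons T S Ss : is_composition T (S :: Ss) =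
  [&& S != set0, S \subset T & is_composition (T :\: S) Ss].
Proof.
apply/idP/and3P => [c|[S0 ST c]].
  have /andP[/eqP TE _] := composition_head c; rewrite (composition_tail c).
  case/and3P: c; rewrite inE negb_or eq_sym => /andP[-> _] _ _.
  by split=> //; rewrite -TE subsetUl.
case/and3P: c => c1 c2 /eqP c3; apply/and3P; split.
- by rewrite inE negb_or eq_sym S0.
- rewrite /= c2 andbT; apply/allP => S' S'S.
  rewrite disjoint_sym disjoints_subset.
  have : S' \subset \bigcup_(S'' <- Ss) S''.
    by rewrite (big_rem S') //= subsetUl.
  by rewrite c3 => /subset_trans; apply; rewrite setDE subsetIr.
- rewrite big_cons c3; apply/eqP/setP => x; rewrite !inE.
  by case: (boolP (x \in S)) => // /(subsetP ST).
Qed.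

(** Two blocks of the same part that cross are in the same run, hence equal.
If a block of the first part crosses a later block, then it has an element
between two elements of the later block, but that block stays within a run of
what is left after removing the first part. *)
Lemma composition_blocks_good T Ss : {subset T <= w} -> is_composition T Ss ->
  good T (composition_blocks T Ss).
Proof.
elim: Ss T => [|S Ss IH] T Tw cT.
  rewrite (composition_nil cT); apply/goodP; split.
  - by rewrite partition_set0.
  - by apply/forall_inP => p; rewrite inE.
  - by move=> p x y; rewrite inE.
move: cT; rewrite composition_cons => /and3P[S0 /subsetP ST cT].
have T'w : {subset T :\: S <= w} by move=> x; rewrite inE => /andP[_ /Tw].
have /goodP[partB ncB cvB] := IH _ T'w cT.
have partA := run_blocks_partition Tw ST.
have cvA p x y : p \in run_blocks T S -> x \in p -> y \in p -> y \in run T x.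
  move=> /(run_blocksP _ ST)[u uS ->]; rewrite !in_setI => /andP[xS xu] /andP[yS yu].
  by rewrite (run_eq (Tw _ (ST _ uS)) xu).
apply/goodP; split=> /=.
- rewrite -[X in partition _ X](setID T S) (setIidPr (introT subsetP ST)).
  by apply: partition_disjointU => //; rewrite disjoint_sym disjoints_subset subsetDr.
- apply/noncrossingP => p q a b c d; rewrite !inE => /orP[]pX /orP[]qX ap bq cp dq ab bc cd.
  + have acT := cvA p a c pX ap cp; have bdT := cvA q b d qX bq dq.
    have memS r x : r \in run_blocks T S -> x \in r -> x \in S.
      by move=> rX xr; apply: (block_mem partA rX xr).
    have [aT bT] := (ST _ (memS _ _ pX ap), ST _ (memS _ _ qX bq)).
    have ab' : b \in run T a.
      case/runP: acT => _ H; apply/runP; split; first exact: Tw.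
      by move=> z zw zI; apply: H => //; pos_lia.
    case/(run_blocksP _ ST): (pX) => u uS E; case/(run_blocksP _ ST): (qX) => v vS F.
    move: ap bq; rewrite E F !in_setI => /andP[_ ua] /andP[_ vb]; congr (_ :&: _).
    rewrite -(run_eq (Tw _ (ST _ uS)) ua) -(run_eq (Tw _ (ST _ vS)) vb).
    by rewrite (run_eq (Tw _ aT) ab').
  + have cS := block_mem partA pX cp; have /runP[_ H] := cvB q b d qX bq dq.
    have /negP[] : c \notin T :\: S by rewrite inE cS.
    by apply: H; [exact/Tw/ST | pos_lia].
  + have bS := block_mem partA qX bq; have /runP[_ H] := cvB p a c pX ap cp.
    have /negP[] : b \notin T :\: S by rewrite inE bS.
    by apply: H; [exact/Tw/ST | pos_lia].
  + exact: (noncrossingP _ _ ncB p q a b c d).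
- move=> p x y; rewrite inE => /orP[pX|pX] xp yp; first exact: cvA pX xp yp.
  exact/(subsetP (runS _ (subsetDl T S)))/(cvB p).
Qed.

End Runs.

(** * Removing the first part *)

Section Sum.
Variables (U : finType) (w : seq U).
Hypothesis uw : uniq w.
Implicit Types (p q r S T : {set U}) (x y z a b c d : U) (P Q X : {set {set U}}).
Implicit Types (Ss : seq {set U}).
Local Notation pos x := (index x w).

(** The sets [S] that can be the first part of a composition producing [P]. *)
Definition removable T P S : bool :=
  [&& S \subset T, run_blocks w T S \subset P
    & good w (T :\: S) (P :\: run_blocks w T S)].

(** The run of the first element of [T], as an interval of positions; the
positions just outside the interval are not in [T]. *)
Lemma run_interval T : {subset T <= w} -> T != set0 ->
  exists x0 j, [/\ x0 \in T, pos x0 < j <= size w,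
    (forall z, (z \in run w T x0) = (z \in w) && (pos x0 <= pos z < j)),
    (forall z, z \in T -> (pos z).+1 != pos x0) & (forall z, z \in T -> pos z != j)].
Proof.
move=> Tw /set0Pn[t tT].
case: (@arg_minnP _ t (mem T) (fun x => pos x) tT) => x0 /= x0T mn.
have x0w := Tw _ x0T; have x0R := run_refl Tw x0T.
case: (@arg_maxnP _ x0 (mem (run w T x0)) (fun x => pos x) x0R) => m /= mR mx.
have RE z : (z \in run w T x0) = (z \in w) && (pos x0 <= pos z < (pos m).+1).
  apply/idP/andP => [zR|[zw zI]].
    have zT := subsetP (run_sub w T x0) z zR.
    by split; [exact: Tw | rewrite (mn z) //= ltnS; apply: mx].
  case/runP: mR => mw H; apply/runP; split=> // u uw' uI; apply: H => //; pos_lia.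
exists x0, (pos m).+1; split=> //.
- have mw : m \in w by case/runP: mR.
  by rewrite ltnS (mn m) ?index_mem //; apply: (subsetP (run_sub w T x0)).
- by move=> z zT; have := mn z zT; pos_lia.
- move=> z zT; apply/eqP => zm.
  suff zR : z \in run w T x0 by have := mx z zR; rewrite /= in zm *; pos_lia.
  apply/runP; split=> [|u uw' uI]; first exact: Tw.
  have [uz|uz] := eqVneq (pos u) (pos z); first by rewrite (index_inj_mem uw' uz).
  by have := mn z zT; case/runP: mR => _ H /= zx; apply: H => //; pos_lia.
Qed.

Lemma run_blocks0 T : run_blocks w T set0 = set0.
Proof. by rewrite /run_blocks /equivalence_partition imset0. Qed.

(** The sets [S] are grouped by their part [S'] outside the first run [R]. Within
a group, the terms other than [S'] itself are the [S' :|: p] with [p] an outer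
block of [R], and they cancel the term of [S'] by [chain_weight_remove] applied
to what [S'] leaves of [P]. *)
Lemma removable_sum T P : {subset T <= w} -> T != set0 -> good w T P ->
  (\sum_(S | removable T P S) coef w (P :\: run_blocks w T S) = 0)%R.
Proof.
move=> Tw T0 gP; have /goodP[partP ncP cvP] := gP.
have [x0 [j [x0T /andP[lt_x0j le_jw] RE xD jD]]] := run_interval Tw T0.
set R := run w T x0 in RE.
have x0w := Tw _ x0T.
have RT : R \subset T := run_sub w T x0.
have runR x : x \in R -> run w T x = R by move=> xR; apply: run_eq.
rewrite (partition_big (fun S => S :\: R) xpredT) //=; apply: big1 => S' _.
(* If the group is not empty, then [S'] itself is removable. *)
case: (pickP (fun S => removable T P S && (S :\: R == S'))) => [S1|none]; last first.
  by rewrite big_pred0.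
case/andP=> rem1 /eqP S1R.
have S'R : S' :&: R = set0 by rewrite -S1R setDE -setIA [~: R :&: R]setIC setICr setI0.
case/and3P: rem1 => S1T bl1 /goodP[part1 _ cv1].
have S'S1 : S' \subset S1 by rewrite -S1R subsetDl.
have S'T : {subset S' <= T} by apply/subsetP/(subset_trans S'S1).
have S1T' := subsetP S1T.
have nR x : x \in S' -> [disjoint R & run w T x].
  move=> xS; apply/pred0P => y /=; apply/negP => /andP[yR yx].
  have xw := Tw _ (S'T _ xS).
  have : x \in S' :&: R by rewrite in_setI xS -(runR y yR); apply: run_sym.
  by rewrite S'R inE.
have blE x : x \in S' -> S' :&: run w T x = S1 :&: run w T x.
  move=> xS; apply/setP => y; rewrite !in_setI -S1R in_setD.
  case: (boolP (y \in run w T x)) => yx; rewrite ?andbF // !andbT.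
  by rewrite (disjointFl (nR x xS) yx).
have bl' : run_blocks w T S' \subset P.
  apply: subset_trans bl1; apply/subsetP => p /(run_blocksP _ _ S'T)[x xS ->].
  by rewrite blE //; apply/(run_blocksP _ _ S1T'); exists x => //; apply: (subsetP S'S1).
set P' := P :\: run_blocks w T S'; set T' := T :\: S'.
have partb := run_blocks_partition Tw S'T.
have part' : partition P' T'.
  by have := partition_setD partP bl'; rewrite (cover_partition partb).
have T'T : T' \subset T by apply: subsetDl.
have P'P : P' \subset P by apply: subsetDl.
have ncS X : X \subset P -> noncrossing w X.
  move=> /subsetP XP; apply/noncrossingP => p q a b c d pX qX.
  by apply: (noncrossingP w P ncP); apply: XP.
(* A block that [S1] keeps has no element of [S1] between its elements; one that
   [S1] removes and [S'] keeps lies in [R], where [S'] has no elements. *)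
have cv' p x y : p \in P' -> x \in p -> y \in p -> y \in run w T' x.
  rewrite in_setD => /andP[pb pP] xp yp; case/runP: (cvP p x y pP xp yp) => yw H.
  apply/runP; split=> // z zw zI; rewrite in_setD H // andbT; apply/negP => zS'.
  have [pb1|npb1] := boolP (p \in run_blocks w T S1); last first.
    have pP1 : p \in P :\: run_blocks w T S1 by rewrite in_setD npb1.
    case/runP: (cv1 p x y pP1 xp yp) => _ /(_ z zw zI).
    by rewrite in_setD (subsetP S'S1).
  case/(run_blocksP _ _ S1T'): pb1 => u uS1 pE.
  have [uR|nuR] := boolP (u \in R).
    have [xR yR] : x \in R /\ y \in R.
      by move: xp yp; rewrite pE !in_setI (runR u uR) => /andP[_ ->] /andP[_ ->].
    have zR : z \in R.
      by move: xR yR; rewrite !RE zw => /andP[_ xI] /andP[_ yI]; pos_lia.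
    have : z \in S' :&: R by rewrite in_setI zS' zR.
    by rewrite S'R inE.
  have uS' : u \in S' by rewrite -S1R in_setD nuR.
  by case/negP: pb; rewrite pE -blE //; apply/(run_blocksP _ _ S'T); exists u.
have good' : good w T' P' by apply/goodP; split=> //; apply: ncS.
have T'w : {subset T' <= w} by move=> x /(subsetP T'T)/Tw.
have RT' : {subset R <= T'}.
  move=> x xR; rewrite in_setD (subsetP RT) // andbT; apply/negP => xS.
  have : x \in S' :&: R by rewrite in_setI xS xR.
  by rewrite S'R inE.
pose X := outer_blocks w P' (pos x0) j.
have chain : chain_weight w P' = \sum_(p in X) chain_weight w (P' :\ p).
  apply: (chain_weight_remove uw part' T'w) => //; first exact: ncS.
  - by move=> z zw zI; apply: RT'; rewrite RE zw.
  - move=> p x y z pP xp yp zw zxy zI.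
    have zR : z \in R by rewrite RE zw.
    have /runP[yw H] := cv' p x y pP xp yp.
    have xR : x \in R.
      rewrite -(runR z zR); apply/runP; split; first exact/T'w/(block_mem part' pP xp).
      by move=> u uw' uI; apply: (subsetP T'T); apply: H => //; pos_lia.
    have yR : y \in R.
      rewrite -(runR z zR); apply/runP; split=> //.
      by move=> u uw' uI; apply: (subsetP T'T); apply: H => //; pos_lia.
    by move: xR yR; rewrite !RE => /andP[_ xI] /andP[_ yI]; pos_lia.
  - by move=> z /(subsetP T'T)/xD.
  - by move=> z /(subsetP T'T)/jD.
have XR p : p \in X -> p \subset R.
  rewrite inE => /and3P[pP _ /forall_inP pI]; apply/subsetP => x xp.
  by rewrite RE pI // (T'w _ (block_mem part' pP xp)).
have X0 p : p \in X -> p != set0.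
  by rewrite inE => /and3P[pP _ _]; apply: contraTneq pP => ->; rewrite (partition0 part').
have blU p : p \in P' -> p \subset R -> run_blocks w T (S' :|: p) = p |: run_blocks w T S'.
  move=> pP pR.
  have S'pT : {subset S' :|: p <= T}.
    by move=> x; rewrite in_setU => /orP[/S'T|/(subsetP pR)/(subsetP RT)].
  apply/setP => q; apply/(run_blocksP _ _ S'pT)/setU1P.
    case=> x; rewrite in_setU => /orP[xS|xp] ->; [right|left].
      apply/(run_blocksP _ _ S'T); exists x => //; apply/setP => y.
      rewrite !in_setI in_setU; case: (boolP (y \in run w T x)) => yx; rewrite ?andbF //.
      have nyp : y \notin p.
        by apply: contraFN (disjointFl (nR x xS) yx); apply: (subsetP pR).
      by rewrite (negPf nyp) orbF.
    have xR := subsetP pR x xp; rewrite (runR x xR) setIUl S'R set0U.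
    exact/setIidPl.
  case=> [->|/(run_blocksP _ _ S'T)[x xS ->]].
    have /set0Pn[x xp] : p != set0.
      by apply: contraTneq pP => ->; rewrite (partition0 part').
    exists x; first by rewrite in_setU xp orbT.
    by rewrite (runR x (subsetP pR x xp)) setIUl S'R set0U; apply/esym/setIidPl.
  exists x; first by rewrite in_setU xS.
  apply/setP => y; rewrite !in_setI in_setU.
  case: (boolP (y \in run w T x)) => yx; rewrite ?andbF //.
  have nyp : y \notin p.
    by apply: contraFN (disjointFl (nR x xS) yx); apply: (subsetP pR).
  by rewrite (negPf nyp) orbF.
have DU (A B C : {set {set U}}) : A :\: (B :|: C) = A :\: C :\: B.
  by apply/setP => q; rewrite !inE; case: (q \in B); case: (q \in C).
have PU p : p \in P' -> p \subset R -> P :\: run_blocks w T (S' :|: p) = P' :\ p.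
  by move=> pP pR; rewrite blU // DU.
have TU p : T :\: (S' :|: p) = T' :\: p.
  by apply/setP => x; rewrite !inE; case: (x \in p); case: (x \in S').
(* Being outer is what it takes for [p] to leave the other blocks within runs. *)
have remU p : p \in P' -> p \subset R -> removable T P (S' :|: p) = (p \in X).
  move=> pP pR; have pI : [forall x in p, pos x0 <= pos x < j].
    by apply/forall_inP => x /(subsetP pR); rewrite RE => /andP[].
  rewrite /removable PU // TU blU // !subUset sub1set (subsetP P'P) // bl'.
  rewrite (introT subsetP S'T) (subset_trans pR RT) /= inE pP pI andbT /=.
  have pp := partitionD1 part' pP.
  apply/goodP/outerP => [[_ _ cv] q x y z qP xq yq zp xz zy|H]; last first.
    split=> //; first by apply: ncS; apply: subset_trans (subsetDl _ _) P'P.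
    move=> q x y; rewrite in_setD1 => /andP[nqp qP] xq yq.
    case/runP: (cv' q x y qP xq yq) => yw K; apply/runP; split=> // z zw zI.
    rewrite in_setD K // andbT; apply: contra nqp => zp; apply/eqP.
    have nx t : t \in q -> pos t = pos z -> q = p.
      move=> tq E; have tz := index_inj_mem (T'w _ (block_mem part' qP tq)) E.
      rewrite tz in tq.
      exact: (block_eq part' qP pP tq zp).
    have [/nx->//|nxz] := eqVneq (pos x) (pos z).
    have [/nx->//|nyz] := eqVneq (pos y) (pos z).
    have [xz|zx] := ltnP (pos x) (pos z).
      by apply: (H q x y z) => //; pos_lia.
    by apply: (H q y x z) => //; pos_lia.
  apply/eqP; apply: contraTT isT => nqp.
  have qP2 : q \in P' :\ p by rewrite in_setD1 nqp.
  case/runP: (cv q x y qP2 xq yq) => _ /(_ z (T'w _ (block_mem part' pP zp))).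
  by rewrite in_setD zp /= => H; apply: H; pos_lia.
(* The other members of the group are indexed by their intersection with [R]. *)
rewrite (bigD1 S') /=; last first.
  rewrite /removable (introT subsetP S'T) bl' good' /=; apply/eqP/setDidPl.
  by rewrite -setI_eq0 S'R.
rewrite (reindex_onto (fun p => S' :|: p) (fun S => S :&: R)) /=; last first.
  by move=> S /andP[/andP[_ /eqP <-] _]; rewrite setUC setID.
rewrite (eq_bigl (mem X)); last first.
  move=> p /=; apply/idP/idP => [/andP[/andP[/andP[rem _] nS'] /eqP pE]|pX].
    have pR : p \subset R by rewrite -pE subsetIr.
    have pE' : p = (S' :|: p) :&: R by rewrite pE.
    have /set0Pn[x xp] : p != set0.
      by apply: contraNneq nS' => ->; rewrite setU0.
    have pP : p \in P'.
      case/and3P: (rem) => /subsetP ST blP _; rewrite in_setD.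
      have xR := subsetP pR x xp; apply/andP; split.
        apply/negP => /(run_blocksP _ _ S'T)[y yS E].
        by move: xp; rewrite E in_setI (disjointFr (nR y yS) xR) andbF.
      apply: (subsetP blP); apply/(run_blocksP _ _ ST); exists x.
        by rewrite in_setU xp orbT.
      by rewrite (runR x xR).
    by rewrite -remU.
  have pR := XR p pX; have pP : p \in P' by case/setIdP: pX.
  have S'p : (S' :|: p) :&: R = p by rewrite setIUl S'R set0U; apply/setIidPl.
  rewrite remU // pX S'p eqxx andbT /=; apply/andP; split.
    rewrite setDUl; move: (pR); rewrite -setD_eq0 => /eqP->; rewrite setU0.
    by apply/eqP/setDidPl; rewrite -setI_eq0 S'R.
  apply: contraNneq (X0 p pX) => E; move: S'p; rewrite E S'R => <-; exact: eqxx.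
rewrite (eq_bigr (fun p => - ((-1) ^+ #|P'| * (chain_weight w (P' :\ p))%:Z)))%R; last first.
  move=> p pX; have pR := XR p pX; have pP : p \in P' by case/setIdP: pX.
  by rewrite PU // coefE [in RHS](cardsD1 p) pP exprS mulN1r mulNr opprK.
rewrite sumrN -mulr_sumr coefE chain.
by rewrite (big_morph Posz PoszD (erefl _)) subrr.
Qed.

End Sum.

(** * The signed count of compositions *)

Section SignedCount.
Variables (U : finType) (w : seq U).
Hypothesis uw : uniq w.
Implicit Types (p q r S T : {set U}) (P Q X : {set {set U}}).
Implicit Types (Ss : seq {set U}).
Local Open Scope ring_scope.

Definition composition_count k T P : int :=
  \sum_(Ss : k.-tuple {set U} | is_composition T Ss)
    (composition_blocks w T Ss == P)%:R.

Definition signed_count n T P : int :=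
  \sum_(k < n.+1) (-1) ^+ k * composition_count k T P.

Lemma composition_count0 T P :
  composition_count 0 T P = ((T == set0) && (P == set0))%:R.
Proof.
rewrite /composition_count big_mkcond (bigD1 [tuple]) //= big1 ?addr0; last first.
  by move=> Ss /eqP[]; apply: tuple0.
by rewrite /is_composition /= big_nil ![set0 == _]eq_sym; case: ifP.
Qed.

(** Splitting off the first part [S]: its blocks must be blocks of [P], and the
other parts must produce the other blocks. *)
Lemma composition_countS k T P : {subset T <= w} ->
  composition_count k.+1 T P =
    \sum_(S | [&& S != set0, S \subset T & run_blocks w T S \subset P])
      composition_count k (T :\: S) (P :\: run_blocks w T S).
Proof.
move=> Tw; rewrite /composition_count.
rewrite (reindex (fun u : {set U} * k.-tuple {set U} => cons_tuple u.1 u.2)) /=; last first.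
  exists (fun t => (thead t, [tuple of behead t])) => [[S Ss] _|t _] /=.
    by congr (_, _); apply: val_inj.
  by rewrite [t in RHS]tuple_eta; apply: val_inj.
rewrite (eq_bigl (fun u : {set U} * k.-tuple {set U} =>
   ((u.1 != set0) && (u.1 \subset T)) && is_composition (T :\: u.1) u.2)); last first.
  by move=> u; rewrite composition_cons andbA.
rewrite -(pair_big_dep (fun S => (S != set0) && (S \subset T))
  (fun S (Ss : k.-tuple {set U}) => is_composition (T :\: S) Ss)
  (fun S (Ss : k.-tuple {set U}) =>
     (run_blocks w T S :|: composition_blocks w (T :\: S) Ss == P)%:R : int)) /=.
have tailE S Ss : S \subset T -> is_composition (T :\: S) Ss ->
    (run_blocks w T S :|: composition_blocks w (T :\: S) Ss == P)
    = (run_blocks w T S \subset P)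
      && (composition_blocks w (T :\: S) Ss == P :\: run_blocks w T S).
  move=> /subsetP ST cSs; have T'w : {subset T :\: S <= w} by move=> x /setDP[/Tw].
  have /goodP[part' _ _] := composition_blocks_good T'w cSs.
  apply: (partition_setU_inj _ (run_blocks_partition Tw ST) part').
  by rewrite disjoint_sym disjoints_subset subsetDr.
rewrite (bigID (fun S => run_blocks w T S \subset P)) /= [X in _ + X]big1 ?addr0.
  apply: eq_big => [S|S /andP[/andP[S0 ST] blP]]; first by rewrite andbA.
  by apply: eq_bigr => Ss cSs; rewrite tailE // blP.
move=> S /andP[/andP[S0 ST] /negPf nblP]; apply: big1 => Ss cSs.
by rewrite tailE // nblP.
Qed.

Lemma composition_count_bad k T P : {subset T <= w} -> ~~ good w T P ->
  composition_count k T P = 0.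
Proof.
move=> Tw bad; apply: big1 => Ss cSs; have gSs := composition_blocks_good Tw cSs.
by case: eqP bad => // <-; rewrite gSs.
Qed.

Lemma signed_countS n T P : {subset T <= w} ->
  signed_count n.+1 T P = ((T == set0) && (P == set0))%:R
    - \sum_(S | [&& S != set0, S \subset T & run_blocks w T S \subset P])
        signed_count n (T :\: S) (P :\: run_blocks w T S).
Proof.
move=> Tw; rewrite /signed_count big_ord_recl /= mul1r composition_count0; congr (_ + _).
rewrite exchange_big -sumrN /=; apply: eq_bigr => k _.
rewrite composition_countS // exprS mulN1r mulNr mulr_sumr.
by rewrite -sumrN.
Qed.

Lemma coef0 : coef w set0 = 1.
Proof.
have part0 : partition (set0 : {set {set U}}) set0 by rewrite partition_set0.
rewrite coefE cards0 mul1r /chain_weight (adjacent_closureE _ part0).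
  by rewrite /equivalence_partition imset0 big_set0.
by move=> x; rewrite inE.
Qed.

(** Both sides satisfy the same recursion over the first part. On the left the
sum runs over all [S] whose blocks are in [P], but the ones that are not
removable leave a partition that no composition produces. *)
Lemma signed_countE n T P : {subset T <= w} -> good w T P -> (#|T| <= n)%N ->
  signed_count n T P = coef w P.
Proof.
elim: n T P => [|n IH] T P Tw gP leTn; have /goodP[partP _ _] := gP.
  have T0 : T = set0 by apply/eqP; rewrite -cards_eq0 -leqn0.
  move: partP; rewrite T0 partition_set0 => /eqP->.
  by rewrite /signed_count big_ord1 mul1r composition_count0 !eqxx coef0.
rewrite signed_countS //; have [T0|T0] /= := eqVneq T set0.
  move: partP; rewrite T0 partition_set0 => /eqP->; rewrite eqxx coef0 big1 ?subr0 //.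
  by move=> S /and3P[S0]; rewrite subset0 (negPf S0).
rewrite sub0r; have := removable_sum uw Tw T0 gP.
rewrite (bigD1 set0) /=; last by rewrite /removable run_blocks0 !setD0 !sub0set.
rewrite run_blocks0 setD0 => /eqP; rewrite addr_eq0 => /eqP->; congr (- _).
rewrite (bigID (fun S => good w (T :\: S) (P :\: run_blocks w T S))) /=.
rewrite [X in _ + X]big1 ?addr0.
  apply: eq_big => [S|S /andP[/and3P[S0 ST blP] gS]].
    by rewrite /removable; case: (S != set0); rewrite ?andbF //= andbT -andbA.
  apply: IH => //; first by move=> x /setDP[/Tw].
  rewrite -ltnS; apply: leq_trans leTn; apply: proper_card; rewrite properE subsetDl /=.
  by apply: contra S0 => /subsetP TS; apply/eqP/setP => x; rewrite inE;
    apply/negP => xS; have := TS x (subsetP ST x xS); rewrite inE xS.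
move=> S /andP[/and3P[S0 ST blP] nS]; apply: big1 => k _.
by rewrite composition_count_bad ?mulr0 // => x /setDP[/Tw].
Qed.

End SignedCount.

(** * From partitions to graphs, and the antipode *)

Section Graph.
Variables (U : finType) (w : seq U).
Hypothesis uw : uniq w.
Implicit Types (p q r S T e : {set U}) (x y z : U) (P Q X : {set {set U}}).
Implicit Types (s t : seq U).
Local Notation pos x := (index x w).

Definition block_graph P : {set {set U}} :=
  \bigcup_(p in P) path_edges [seq x <- w | x \in p].

Lemma mem_path_edges x0 s e : reflect
  (exists2 i, i.+1 < size s & e = [set nth x0 s i; nth x0 s i.+1])
  (e \in path_edges s).
Proof.
elim: s => [|x [|y s] IH].
- by rewrite inE; constructor; case.
- by rewrite inE; constructor; case.
rewrite path_edges_cons2 in_setU1;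
apply: (iffP orP) => [[/eqP->|/IH[i lt_i ->]]|[[|i] lt_i E]].
- by exists 0.
- by exists i.+1.
- by left; rewrite E.
- by right; apply/IH; exists i.
Qed.

Lemma adj_path x y : x \in w -> y \in w ->
  adj (path_edges w) x y = (pos y == (pos x).+1) || (pos x == (pos y).+1).
Proof.
move=> xw yw; apply/(mem_path_edges x)/orP => [[i lt_i E]|].
  have xE : x \in [set x; y] by rewrite set21.
  have yE : y \in [set x; y] by rewrite set22.
  have nxi : nth x w i != nth x w i.+1.
    by rewrite nth_uniq //; [rewrite neq_ltn ltnSn | exact: ltnW].
  have : nth x w i \in [set x; y] by rewrite E set21.
  have : nth x w i.+1 \in [set x; y] by rewrite E set22.
  rewrite !inE => /orP[]/eqP E1 /orP[]/eqP E2; move: nxi; rewrite ?E1 ?E2 ?eqxx // => _;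
    have := congr1 (index^~ w) E1; have := congr1 (index^~ w) E2;
    rewrite /= !index_uniq // 1?ltnW // => <- <-; rewrite eqxx; [by right | by left].
case=> /eqP E; [exists (pos x)|exists (pos y)]; rewrite -?E ?index_mem ?nth_index //.
by rewrite setUC.
Qed.

(** Consecutive vertices of a run are joined by an edge; conversely an edge of the
induced subgraph joins neighbouring positions, so it does not leave a run. *)
Lemma component_run T x : {subset T <= w} -> x \in T ->
  component (induced (path_edges w) T) x = run w T x.
Proof.
move=> Tw xT; have aE u v : adj (induced (path_edges w) T) u v =
    [&& u \in T, v \in T & (pos v == (pos u).+1) || (pos u == (pos v).+1)].
  rewrite /adj inE subUset !sub1set andbC andbA.
  case: (boolP (u \in T)) => //= uT; case: (boolP (v \in T)) => //= vT.
  by rewrite -adj_path //; apply: Tw.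
apply/setP => y; rewrite inE; apply/idP/idP.
  case/connectP=> s; elim: s x xT => [|z s IH] x xT /=; first by move=> _ ->; apply: run_refl.
  rewrite aE => /andP[/and3P[_ zT xz] zs] ys; apply: run_trans (IH z zT zs ys).
  apply/runP; split=> [|u uw' uI]; first exact: Tw.
  have [ux|ux] := eqVneq (pos u) (pos x); first by rewrite (index_inj_mem uw' ux).
  by have -> : u = z by apply: (index_inj_mem uw'); pos_lia.
have H n u v : v \in run w T u -> u \in T -> pos v = pos u + n ->
    connect (adj (induced (path_edges w) T)) u v.
  elim: n u => [|n IH] u vu uT E.
    rewrite addn0 in E; have [vw _] := runP _ _ _ _ vu.
    by rewrite (index_inj_mem vw E) connect0.
  have [vw K] := runP _ _ _ _ vu; have lt_u : (pos u).+1 < size w.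
    by have := vw; rewrite -index_mem E; apply: leq_ltn_trans; rewrite addnS ltnS leq_addr.
  pose u' := nth u w (pos u).+1.
  have pu' : pos u' = (pos u).+1 by rewrite index_uniq.
  have uw' : u' \in w by apply: mem_nth.
  have uT' : u' \in T by apply: K => //; pos_lia.
  apply: (@connect_trans _ _ u'); first by apply: connect1; rewrite aE uT uT' pu' eqxx.
  apply: (IH u') => //; last by rewrite pu' E; pos_lia.
  by apply/runP; split=> // z zw zI; apply: K => //; pos_lia.
move=> yx; have yT := subsetP (run_sub w T x) y yx.
have [xy|/ltnW yx'] := leqP (pos x) (pos y).
  by apply: (H (pos y - pos x)) => //; rewrite subnKC.
rewrite connect_adjC; apply: (H (pos x - pos y)) => //; last by rewrite subnKC.
exact: run_sym (Tw _ xT) yx.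
Qed.

Lemma run_orders T x : {subset T <= w} -> x \in T ->
  [seq y <- w | y \in run w T x] \in
    orders (induced (path_edges w) T) (component (induced (path_edges w) T) x).
Proof.
move=> Tw xT; have [ss [fss _ iss]] := induced_path T uw.
have uss : uniq (flatten ss) by rewrite fss filter_uniq.
have /flattenP[t tss xt] : x \in flatten ss by rewrite fss mem_filter xT Tw.
have RE := path_component uss iss tss xt; rewrite component_run // in RE.
have st : subseq t w.
  apply: subseq_trans (filter_subseq [in T] w); rewrite -fss.
  case/splitPr: tss => s1 s2; rewrite flatten_cat /=.
  exact: subseq_trans (prefix_subseq t _) (suffix_subseq _ _).
suff -> : [seq y <- w | y \in run w T x] = t by exact: (path_orders uss iss tss xt).
have /(subseq_uniqP uw) tE := st; rewrite [RHS]tE.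
by apply: eq_filter => y; rewrite RE inE.
Qed.

(** The paths of the induced subgraph on [T] are the runs of [T] in the order of
[w] ([run_orders]), and reversing a listing does not change its edges. *)
Lemma shortcut_induced T S : {subset T <= w} -> {subset S <= T} ->
  shortcut T (induced (path_edges w) T) S = block_graph (run_blocks w T S).
Proof.
move=> Tw ST; set E := induced _ _.
have fE x : [seq y <- [seq y <- w | y \in run w T x] | y \in S]
    = [seq y <- w | y \in S :&: run w T x].
  by rewrite -filter_predI; apply: eq_filter => y; rewrite /= in_setI.
have sE x s : x \in T -> s \in orders E (component E x) ->
    path_edges [seq y <- s | y \in S] = path_edges [seq y <- w | y \in S :&: run w T x].
  move=> xT /ordersP[us ms Es]; have /ordersP[ut mt Et] := run_orders Tw xT.
  have [||->|->] := path_edges_inj us ut; rewrite ?Es ?Et //.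
  - by move=> y; rewrite ms mt.
  - by rewrite fE.
  - by rewrite filter_rev path_edges_rev fE.
apply/setP => e; apply/bigcupP/bigcupP.
  case=> x xT /mem_bigcup_seq[s sO]; rewrite (sE x s xT sO) => eE.
  case Ef: [seq _ <- _ | _] (eE) => [|y t]; first by rewrite inE.
  have : y \in [seq y <- w | y \in S :&: run w T x] by rewrite Ef mem_head.
  rewrite mem_filter in_setI -andbA => /and3P[yS yx yw] _.
  exists (S :&: run w T x) => //; apply/(run_blocksP _ _ ST); exists y => //.
  by rewrite (run_eq (Tw _ xT) yx).
case=> _ /(run_blocksP _ _ ST)[x xS ->] eE; exists x; first exact: ST.
apply/mem_bigcup_seq; exists [seq y <- w | y \in run w T x].
  exact/run_orders/ST.
by rewrite fE.
Qed.

Lemma iter_antipode_term Ss T (cT : is_composition T Ss) (alpha : pathsets T) :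
  {subset T <= w} -> val alpha = induced (path_edges w) T ->
  val (iter_product cT (iter_coproduct cT alpha))
    = block_graph (composition_blocks w T Ss).
Proof.
elim: Ss T cT alpha => [|S Ss IH] T cT alpha Tw aE.
  by rewrite /= /block_graph big_set0.
have ST : {subset S <= T}.
  by apply/subsetP; move: (cT); rewrite composition_cons => /and3P[].
have tailE := IH _ (composition_tail cT) (coproduct (composition_head cT) alpha).2.
transitivity (shortcut T (val alpha) S :|: val (iter_product (composition_tail cT)
    (iter_coproduct (composition_tail cT) (coproduct (composition_head cT) alpha).2))).
  by [].
rewrite tailE ?aE ?shortcut_induced //.
- by rewrite /block_graph bigcup_setU.
- by move=> x /setDP[/Tw].
rewrite /= aE; apply/setP => e; rewrite !inE -andbA; congr (_ && _).
case: (boolP (e \subset T :\: S)) => [eTS|]; rewrite ?andbF // andbT.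
exact: subset_trans eTS (subsetDl _ _).
Qed.

Lemma component_block_graph P (D : {set U}) p x : w =i D -> partition P D ->
  p \in P -> x \in p -> component (block_graph P) x = p.
Proof.
move=> wD partP pP xp; pose f p := [seq y <- w | y \in p].
have fP q : q \in P -> perm_eq (f q) (enum q).
  move=> qP; apply: uniq_perm => [||y]; [exact: filter_uniq | exact: enum_uniq |].
  rewrite mem_filter mem_enum wD andbC; case: (boolP (y \in q)) => yq; rewrite ?andbF //.
  by rewrite (block_mem partP qP yq).
have uss : uniq (flatten [seq f q | q <- enum P]).
  by rewrite (perm_uniq (perm_flatten_blocks partP fP)) enum_uniq.
have gE : block_graph P = \bigcup_(s <- [seq f q | q <- enum P]) path_edges s.
  by rewrite big_map big_enum.
have fpP : f p \in [seq f q | q <- enum P] by rewrite map_f // mem_enum.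
have xf : x \in f p by rewrite (perm_mem (fP p pP)) mem_enum.
rewrite (path_component uss gE fpP xf); apply/setP => y.
by rewrite inE (perm_mem (fP p pP)) mem_enum.
Qed.

(** A partition is recovered from its graph as the set of connected components. *)
Lemma block_graph_inj P Q (D : {set U}) : w =i D -> partition P D -> partition Q D ->
  block_graph P = block_graph Q -> P = Q.
Proof.
move=> wD; wlog suff H : P Q / partition P D -> partition Q D ->
    block_graph P = block_graph Q -> P \subset Q.
  by move=> pP pQ E; apply/eqP; rewrite eqEsubset !H.
move=> pP pQ E; apply/subsetP => p pP'.
have /set0Pn[x xp] : p != set0 by apply: contraTneq pP' => ->; rewrite (partition0 pP).
have : x \in D := block_mem pP pP' xp.
rewrite -(cover_partition pQ) => /bigcupP[q qQ xq].
by rewrite -(component_block_graph wD pP pP' xp) E (component_block_graph wD pQ qQ xq).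
Qed.

End Graph.

Lemma linearize_basis (K : fieldType) (A B : finType) (f : A -> B) a :
  linearize f (basis_vector K a) = basis_vector K (f a).
Proof.
rewrite /linearize (bigD1 a) //= ffunE eqxx scale1r big1 ?addr0 // => b nab.
by rewrite ffunE (negPf nab) scale0r.
Qed.

Local Open Scope ring_scope.

Theorem theorem25p4 (K : fieldType) (charK : [pchar K] =i pred0)
    (U : finType) (I : {set U}) (l : pathsets I) (lP : is_path l)
    (w : seq U) (lw : w \in orders (val l) I) :
  [/\ antipode (basis_vector K l)
        = \sum_(P : noncrossing_partition I w)
            (coef w (val P))%:~R *: basis_vector K (linear_graph lw P),
      cancellation_free (fun P : noncrossing_partition I w => coef w (val P))
                        (linear_graph lw)
    & grouping_free (linear_graph lw)].
Proof.
have /ordersP[uw wI Ew] := lw.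
have Iw : {subset I <= w} by move=> x; rewrite wI.
have lE : val l = path_edges w.
  rewrite Ew; apply/setP => e; rewrite inE; case: (boolP (e \in val l)) => //= el.
  by case/andP: (valP l) => /forall_inP/(_ e el)/andP[_ ->].
have partP (P : noncrossing_partition I w) : partition (val P) I by case/andP: (valP P).
have gf : grouping_free (linear_graph lw).
  move=> P Q; apply: contra => /eqP/(congr1 val) E; apply/eqP/val_inj.
  exact: (block_graph_inj uw wI (partP P) (partP Q) E).
split=> //; last by move=> P Q nPQ E; have := gf P Q nPQ; rewrite E eqxx.
have I0 : I != set0.
  by case/exists_inP: lP => x xI _; apply: contraTneq xI => ->; rewrite inE.
have goodI (P : noncrossing_partition I w) : good w I (val P).
  case/andP: (valP P) => pP nc; apply/goodP; split=> // p x y pP' xp yp.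
  apply/runP; split=> [|z]; last by rewrite wI.
  exact: Iw (block_mem pP pP' yp).
rewrite /antipode (negPf I0).
have termE k (Ss : {Ss : k.-tuple {set U} | is_composition I Ss}) :
    basis_vector K (iter_product (valP Ss) (iter_coproduct (valP Ss) l))
    = \sum_(P : noncrossing_partition I w)
        (composition_blocks w I (val Ss) == val P)%:R *: basis_vector K (linear_graph lw P).
  have gSs := composition_blocks_good Iw (valP Ss).
  have ncSs : partition (composition_blocks w I (val Ss)) I
      && noncrossing w (composition_blocks w I (val Ss)) by case/and3P: gSs => -> ->.
  pose P0 : noncrossing_partition I w :=
    exist (fun P : {set {set U}} => partition P I && noncrossing w P) _ ncSs.
  rewrite (bigD1 P0) //= eqxx scale1r big1 ?addr0 => [|P nP].
    congr basis_vector; apply: val_inj; apply: iter_antipode_term => //.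
    by rewrite lE {1}Ew lE.
  case: eqP => [E|]; last by rewrite scale0r.
  by case/eqP: nP; apply: val_inj.
(* The coefficients of each basis vector are collected. *)
under eq_bigr => k _.
  under eq_bigr => Ss _ do rewrite !linearize_basis termE scaler_sumr.
  rewrite exchange_big /=; over.
rewrite exchange_big /=; apply: eq_bigr => P _.
rewrite -(signed_countE uw Iw (goodI P) (leqnn _)).
rewrite /signed_count big_ord_recl /= mul1r composition_count0 (negPf I0) add0r.
rewrite big_add1 /= big_mkord rmorph_sum scaler_suml; apply: eq_bigr => k _.
rewrite rmorphM rmorphXn rmorphN1 rmorph_sum /= -scalerA scaler_suml scaler_sumr.
under [RHS]eq_bigr => Ss _ do rewrite rmorph_nat.
exact/esym/(big_sub [pred Ss : k.+1.-tuple {set U} | is_composition I Ss]).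
Qed.
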